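(* Work in the Gaussian white noise model described in the context, where the true sparsity $s=\operatorname{Card}(J)$ and its known upper estimate $d^*$ are such that $d^*/s$ is bounded from above by some constant. There is a constant $D^*$ depending only on $L$ such that if $$\kappa\ge D^*\left\{\left(\frac{\log(d/s)}{n^2}\right)^{2/(4+s)}\vee\frac{s\log(d/s)}{n}\right\},$$ then there exists a consistent estimator of $J$. Furthermore, the consistency is uniform in $f\in\Sigma(\kappa,L)$. On the other hand, there is a constant $D_*$ depending only on $L$ such that if $$\kappa\le D_*\left\{\left(\frac{\log(d/s)}{n^2}\right)^{2/(4+s)}\vee\frac{s\log(d/s)}{n}\right\},$$ then uniformly consistent estimation of $J$ is impossible.
   Context: $a\vee b=\max(a,b)$. The setting is asymptotic: $n\to\infty$ and $d=d_n\to\infty$, while $1\le s=s_n\le d^*=d^*_n\le d$ and $\kappa=\kappa_n>0$ may depend on $n$, $L>0$ is fixed and $d^*/s$ is bounded by a fixed constant. An estimator $\widehat J_n$ is uniformly consistent if $\sup_{f\in\Sigma(\kappa,L)}\mathbf P_f(\widehat J_n\neq J_f)\to0$; uniformly consistent estimation is impossible if no estimator has this property. Fourier basis: for $\mathbf k\in\mathbb Z^d$, $\varphi_{\mathbf 0}\equiv1$, $\varphi_{\mathbf k}(\mathbf x)=\sqrt2\cos(2\pi\mathbf k\cdot\mathbf x)$ if $\mathbf k\in(\mathbb Z^d)_+$ and $\varphi_{\mathbf k}(\mathbf x)=\sqrt2\sin(2\pi\mathbf k\cdot\mathbf x)$ if $-\mathbf k\in(\mathbb Z^d)_+$, where $(\mathbb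 Z^d)_+$ is the set of $\mathbf k\in\mathbb Z^d\setminus\{0\}$ whose first nonzero coordinate is positive. For $f\in L^2([0,1]^d)$, $\theta_{\mathbf k}[f]=\int_{[0,1]^d}f\varphi_{\mathbf k}$. The class $\Sigma(\kappa,L)$ consists of all $f\in L^2([0,1]^d)$ such that $\sum_{\mathbf k\in\mathbb Z^d}k_j^2\theta_{\mathbf k}[f]^2\le L$ for all $j\in\{1,\dots,d\}$ and such that for some $J=J_f\subset\{1,\dots,d\}$ with $\operatorname{Card}(J_f)=s$ (the sparsity pattern of $f$) there is a function $\bar f:\mathbb R^{s}\to\mathbb R$ with $f(\mathbf x)=\bar f(\mathbf x_{J_f})$ for all $\mathbf x$ ($\mathbf x_J$ being the subvector of coordinates with index in $J$), and $\sum_{\mathbf k:k_j\neq0}\theta_{\mathbf k}[f]^2\ge\kappa$ for all $j\in J_f$. Gaussian white noise model: under $\mathbf P_f$ one observes a Gaussian process $\{\mathbf Y(\phi):\phi\in L^2([0,1]^d)\}$ with mean $\int f\phi$ and covariance $\operatorname{Cov}(\mathbf Y(\phi),\mathbf Y(\phi'))=\frac1n\int\phi\phi'$; equivalently one observes $y_{\mathbf k}=\theta_{\mathbf k}[f]+n^{-1/2}\xi_{\mathbf k}$, $\mathbf k\in\mathbb Z^d$, with $\xi_{\mathbf k}$ i.i.d. $N(0,1)$.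
   Formalization: In the impossibility part the class Σ(κ,L) is additionally assumed nonempty for all large n; for κ > L it is empty, every estimator is then vacuously uniformly consistent, and the claim as stated fails. *)

(* Defs.v *)
From HB Require Import structures.
From mathcomp Require Import all_boot all_order all_algebra.
From mathcomp Require Import all_classical all_reals all_analysis.

Set Implicit Arguments.
Unset Strict Implicit.
Unset Printing Implicit Defensive.

Import Order.TTheory GRing.Theory Num.Theory.
Import numFieldNormedType.Exports.

Local Open Scope classical_set_scope.
Local Open Scope ring_scope.

Notation point R d := (d.-tuple (measurableTypeR R)) (only parsing).
Notation freq d := {ffun 'I_d -> int}.

Section cube.
Variable R : realType.

Definition cons_point (d : nat) (p : measurableTypeR R * point R d) :
  point R d.+1 := [tuple of p.1 :: p.2].

Lemma measurable_cons_point d : measurable_fun setT (@cons_point d).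
Proof. exact: measurable_cons. Qed.

HB.instance Definition _ d :=
  isMeasurableFun.Build _ _ _ _ (@cons_point d) (@measurable_cons_point d).

(* Lebesgue measure on [0, 1]^d, as a measure on R^d carried by the cube: the
   d-fold product of the uniform probability on [0, 1]. *)
Fixpoint cube_measure (d : nat) : probability (point R d) R :=
  match d return probability (point R d) R with
  | 0 => \d_([tuple] : point R 0)
  | d'.+1 => distribution (uniform_prob (@ltr01 R) \x cube_measure d')%E
                          (@cons_point d')
  end.

Definition cube (d : nat) : set (point R d) :=
  [set x | forall j, 0 <= (tnth x j : R) <= 1].

Definition subvector (d : nat) (J : {set 'I_d}) (x : point R d) :
  point R #|J| := [tuple tnth x (enum_val i) | i < #|J|].

Definition freq_pos (d : nat) (k : freq d) : bool :=
  [exists j, (0 < k j) && [forall i : 'I_d, (i < j)%N ==> (k i == 0)]].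

Definition dot (d : nat) (k : freq d) (x : point R d) : R :=
  \sum_(j < d) (k j)%:~R * (tnth x j : R).

Definition fourier (d : nat) (k : freq d) (x : point R d) : R :=
  if k == 0 then 1
  else if freq_pos k then Num.sqrt 2 * cos (2 * pi * dot k x)
  else Num.sqrt 2 * sin (2 * pi * dot k x).

Definition theta (d : nat) (f : point R d -> R) (k : freq d) : R :=
  \int[cube_measure d]_x (f x * fourier k x).

End cube.

Section sparse_class.
Variables (R : realType) (d : nat).
Implicit Types (f : point R d -> R) (kappa L : R) (s : nat) (J : {set 'I_d}).

(* J is the pattern J_f; it is determined by f as soon as 0 < kappa. *)
Definition is_sparsity_pattern kappa s f J : Prop :=
  [/\ #|J| = s,
      exists fbar : point R #|J| -> R,
        forall x, cube x -> f x = fbar (subvector J x)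
    & forall j, j \in J ->
        (kappa%:E <= \esum_(k in [set k : freq d | k j != 0%R])
                       ((theta f k) ^+ 2)%:E)%E].

Definition Sigma kappa L s : set (point R d -> R) :=
  [set f | [/\ f \in Lfun (cube_measure R d) 2%:E,
      forall j, (\esum_(k in [set: freq d])
                   (((k j)%:~R * theta f k) ^+ 2)%:E <= L%:E)%E
    & exists J, is_sparsity_pattern kappa s f J]].

End sparse_class.

Definition mutually_independent (R : realType) (disp : measure_display)
    (T : measurableType disp) (P : probability T R) (I : eqType)
    (X : I -> {RV P >-> R}) : Prop :=
  forall r : seq I, uniq r ->
  forall A : I -> set R, (forall i, measurable (A i)) ->
    P (\bigcap_(i in [set` r]) (X i @^-1` A i))
    = (\prod_(i <- r) P (X i @^-1` A i))%E.

Record white_noise (R : realType) (d : nat) := WhiteNoise {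
  wn_disp : measure_display;
  wn_space : measurableType wn_disp;
  wn_prob : probability wn_space R;
  wn_xi : freq d -> {RV wn_prob >-> R};
  wn_gaussian : forall k (A : set R), measurable A ->
    distribution wn_prob (wn_xi k) A = normal_prob 0 1 A;
  wn_indep : mutually_independent wn_xi }.

Record estimator (R : realType) (d : nat) := Estimator {
  estimate :> (freq d -> R) -> {set 'I_d};
  estimate_measurable : forall J : {set 'I_d},
    <<s [set (fun y : freq d -> R => y k) @^-1` B
        | k in [set: freq d] & B in (measurable : set (set R))] >>
      [set y | estimate y = J] }.

Section risk.
Variables (R : realType) (d : nat) (W : white_noise R d) (n : nat).

Definition observation (f : point R d -> R) (w : wn_space W) (k : freq d) : R :=
  theta f k + (Num.sqrt n%:R)^-1 * wn_xi W k w.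

Definition error_prob (Jhat : estimator R d) (f : point R d -> R)
    (J : {set 'I_d}) : \bar R :=
  wn_prob W [set w | Jhat (observation f w) <> J].

(* The union with {0} makes the supremum over an empty class 0, not -oo. *)
Definition worst_error (kappa L : R) (s : nat) (Jhat : estimator R d) : \bar R :=
  ereal_sup ([set 0%E] `|` [set e | exists f J,
    [/\ Sigma kappa L s f, is_sparsity_pattern kappa s f J
      & e = error_prob Jhat f J]]).

End risk.

Definition uniformly_consistent (R : realType) (d : nat -> nat)
    (W : forall n, white_noise R (d n)) (kappa : nat -> R) (L : R)
    (s : nat -> nat) (Jhat : forall n, estimator R (d n)) : Prop :=
  worst_error (W n) n (kappa n) L (s n) (Jhat n) @[n --> \oo] --> 0%E.

Definition sparsity_regime (R : realType) (C : R) (s dstar d : nat -> nat) : Prop :=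
  forall n, [/\ (1 <= s n)%N, (s n <= dstar n)%N, (dstar n <= d n)%N
              & (dstar n)%:R / (s n)%:R <= C].

Definition rate (R : realType) (n d s : nat) : R :=
  Num.max ((ln (d%:R / s%:R) / n%:R ^+ 2) `^ (2 / (4 + s%:R)))
          (s%:R * ln (d%:R / s%:R) / n%:R).

(* Main.v *)
From HB Require Import structures.
Require Import Defs.
From mathcomp Require Import all_boot all_order all_algebra.
From mathcomp Require Import all_classical all_reals all_analysis.
From mathcomp Require Import measurable_realfun.
From mathcomp Require Import ring lra zify.
Import Order.TTheory GRing.Theory Num.Theory.
Import numFieldNormedType.Exports.
Local Open Scope classical_set_scope.
Local Open Scope ring_scope.
Set Implicit Arguments.
Unset Strict Implicit.
Unset Printing Implicit Defensive.

Local Notation point R d := (d.-tuple (measurableTypeR R)) (only parsing).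

(* Upper bound. A function f of the class has theta_k[f] = 0 unless k is supported
   by J, and the Sobolev condition confines half of the energy kappa of each relevant
   coordinate j to the frequencies k with k_j <> 0 in an l1-ball of radius s sqrt(2L/kappa),
   which contains at most (C sqrt(L/kappa))^s points supported by J. The centred energy
   of the observations over such a ball therefore separates j in J from j not in J, and
   a Chernoff bound makes all the tests, over all sets J' and all j in J', correct
   simultaneously with probability at least 1 - 3/d. A union bound over s costs nothing,
   so s need not be known; only for s = d, where the rate vanishes, the pattern is
   trivial and must be announced separately.

   Lower bound. For #|J| = s put random signs on s-dimensional cosines with frequencies
   in {1, ..., m}^J and equal amplitudes sqrt(kappa/N), N = m^s. The likelihood ratio
   averaged over the signs has second moment cosh(n kappa/N)^N, and an estimator that
   recovers J with probability p for each of the binomial(d, s) mixtures satisfies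
   p <= 1/4 + cosh(n kappa/N)^N / binomial(d, s). Taking m close to sqrt(L/kappa) deals
   with the first term of the rate and m = 1 with the second. *)

(** Both terms of the rate come from one Chernoff exponent. For N test frequencies it is of order
    min(n kappa, (n kappa)^2 / N), and it must exceed a multiple of s (ln(d/s) + 1), a bound for the
    logarithm of binomial(d, s). The linear branch gives s ln(d/s) / n. In the quadratic one N = (C
    sqrt(L/kappa))^s turns the condition into kappa^((4+s)/2) >= const^s ln(d/s) / n^2. Factors
    polynomial in s disappear into const^s, which is why the constants depend on L alone although s
    is unbounded. In the lower bound the two regimes are cosh x <= exp x and cosh x <= exp(2 x^2) at
    x = n kappa / N. The radius of the l1-ball carries the factor s because the Sobolev condition
    holds coordinate by coordinate: summed over J it gives s L, while sum_J k_i^2 >= s q^2 outside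
    the ball of radius s q, so that s cancels. The delicate range is s close to d: ln(d/s) may tend
    to 0 there, while the bound (e d/s)^s for the binomial coefficient stays exponential in s. *)

(** * Integrals of functions of random variables, independence *)

Section weighted_integrals.
Import HBNNSimple.
Local Open Scope ereal_scope.
Context d1 d2 d (T1 : measurableType d1) (T2 : measurableType d2)
  (U : measurableType d) (R : realType).
Variables (m1 : {measure set T1 -> \bar R}) (m2 : {measure set T2 -> \bar R}).
Variables (X1 : T1 -> U) (X2 : T2 -> U) (h1 : T1 -> R) (h2 : T2 -> R).

Let lin d' (T : measurableType d') (m : {measure set T -> \bar R})
    (X : T -> U) (h : T -> R) (f : {nnsfun U >-> R}) :
  measurable_fun setT X -> measurable_fun setT h -> (forall x, (0 <= h x)%R) ->
  \int[m]_x ((f (X x)) * h x)%:E = \sum_(r \in range f)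
    (r%:E * \int[m]_x (\1_(f @^-1` [set r]) (X x) * h x)%:E).
Proof.
move=> mX mh h0.
have mterm r : measurable_fun setT
    (fun x => \1_(f @^-1` [set r]) (X x) * h x)%R.
  apply: measurable_funM => //.
  by apply: measurableT_comp => //; exact: measurable_indic.
under eq_integral.
  move=> x _; rewrite EFinM fimfunE -fsumEFin// ge0_mule_fsuml; last first.
    by move=> r; exact: nnfun_muleindic_ge0.
  under eq_fsbigr do rewrite EFinM -muleA -EFinM.
  over.
rewrite ge0_integral_fsum//=; last 2 first.
- by move=> r; apply/measurable_EFinP/measurable_funM.
- move=> r x _; rewrite mulrA lee_fin mulr_ge0//.
  by rewrite -lee_fin; exact: nnfun_muleindic_ge0.
apply: eq_fsbigr => r /[!inE] -[y _ <-].
under eq_integral do rewrite EFinM.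
rewrite ge0_integralZl_EFin//; [|exact/measurable_EFinP].
by move=> x _; rewrite lee_fin mulr_ge0.
Qed.

Let approx d' (T : measurableType d') (m : {measure set T -> \bar R})
    (X : T -> U) (h : T -> R) (f : U -> R)
    (mf : measurable_fun setT (EFin \o f)) :
  (forall u, (0 <= f u)%R) ->
  measurable_fun setT X -> measurable_fun setT h -> (forall x, (0 <= h x)%R) ->
  \int[m]_x ((f (X x)) * h x)%:E =
  lim (\int[m]_x (nnsfun_approx measurableT mf n (X x) * h x)%:E @[n --> \oo]).
Proof.
move=> f0 mX mh h0; rewrite -monotone_convergence//=.
- apply: eq_integral => x _; apply/esym/cvg_lim => //.
  under eq_fun do rewrite EFinM.
  rewrite EFinM; apply: cvgeZr => //.
  by apply: (cvg_nnsfun_approx measurableT mf) => // y _; rewrite lee_fin.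
- move=> n; apply/measurable_EFinP/measurable_funM => //.
  exact: measurableT_comp.
- by move=> n x _; rewrite lee_fin mulr_ge0.
- move=> x _ i j ij; rewrite lee_fin ler_wpM2r//.
  exact/lefP/nd_nnsfun_approx.
Qed.

Hypotheses (mX1 : measurable_fun setT X1) (mX2 : measurable_fun setT X2).
Hypotheses (mh1 : measurable_fun setT h1) (mh2 : measurable_fun setT h2).
Hypotheses (h1_ge0 : forall x, (0 <= h1 x)%R) (h2_ge0 : forall x, (0 <= h2 x)%R).

(** Indicators, then simple functions, then monotone limits. The weights let one statement cover a
    change of variable, a density, and the splitting off of one independent factor. *)
Lemma ge0_integral_weight_ext (f : U -> R) :
  (forall B, measurable B -> \int[m1]_x (\1_B (X1 x) * h1 x)%:E =
                             \int[m2]_x (\1_B (X2 x) * h2 x)%:E) ->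
  measurable_fun setT f -> (forall u, (0 <= f u)%R) ->
  \int[m1]_x (f (X1 x) * h1 x)%:E = \int[m2]_x (f (X2 x) * h2 x)%:E.
Proof.
move=> hB mf f0.
have mf' : measurable_fun setT (EFin \o f) by exact/measurable_EFinP.
rewrite !(approx _ mf')//; congr (limn _); apply/funext => n.
by rewrite !lin//; apply: eq_fsbigr => r _; rewrite hB.
Qed.

End weighted_integrals.

Section independence.
Local Open Scope ereal_scope.
Context d (T : measurableType d) (R : realType) (P : probability T R)
  (I : eqType) (X : I -> {RV P >-> R}).

(** Independence is given for events only, so indicators are replaced by the [f i] one index at a
    time. The induction therefore runs over [r1] with a product of indicators over [r2] carried
    along, for arbitrary [r2] and [A]. *)
Lemma mutually_independent_expectation_prod (r : seq I) (f : I -> R -> R)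
    (p : I -> R) :
  mutually_independent X -> uniq r ->
  (forall i, measurable_fun setT (f i)) -> (forall i x, (0 <= f i x)%R) ->
  (forall i, \int[P]_w (f i (X i w))%:E = (p i)%:E) ->
  \int[P]_w (\prod_(i <- r) f i (X i w))%:E = (\prod_(i <- r) p i)%:E.
Proof.
move=> iX ur mf f0 fp.
suff: forall r1 r2 (A : I -> set R), (forall i, measurable (A i)) ->
    uniq (r1 ++ r2) ->
    \int[P]_w (\prod_(i <- r1) f i (X i w) *
               \prod_(i <- r2) \1_(A i) (X i w))%:E =
    (\prod_(i <- r1) p i * \prod_(i <- r2) fine (P (X i @^-1` A i)))%:E.
  move=> /(_ r [::] (fun=> setT)); rewrite cats0 big_nil mulr1 => <- //.
  by apply: eq_integral => w _; rewrite big_nil mulr1.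
elim=> [|i r1 IH] r2 A mA; rewrite ?cat0s ?cat_cons ?cons_uniq.
  move=> ur2; rewrite big_nil mul1r.
  have -> : (\prod_(i <- r2) fine (P (X i @^-1` A i)))%:E =
      \prod_(i <- r2) P (X i @^-1` A i).
    rewrite (big_morph _ EFinM (erefl _)); apply: eq_bigr => i _.
    by rewrite fineK// fin_num_measure// -[X in measurable X]setTI; exact: measurable_funP.
  rewrite -iX//.
  under eq_integral do rewrite big_nil mul1r.
  rewrite -[in RHS](setIT (\bigcap_(_ in _) _)) -integral_indic//; last first.
    apply: fin_bigcap_measurable => [|j _]; first exact: finite_seq.
    by rewrite -[X in measurable X]setTI; exact: measurable_funP.
  apply: eq_integral => w _; congr (_%:E).
  rewrite indicE; case: (boolP (_ \in _)) => [|]; rewrite ?inE.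
    by move=> H; rewrite big_seq big1// => j jr; rewrite indicE mem_set//; exact: H.
  rewrite notin_setE => /existsNP[j] /not_implyP[/= jr Aj].
  by rewrite (big_rem j)//= indicE memNset// mul0r.
rewrite mem_cat negb_or -andbA => /and3P[ir1 ir2 ur12].
pose h w := (\prod_(i <- r1) f i (X i w) * \prod_(i <- r2) \1_(A i) (X i w))%R.
have mind j (B : set R) : measurable B -> measurable_fun setT (fun w => \1_B (X j w) : R).
  by move=> mB; apply: measurableT_comp => //; exact: measurable_indic.
have mh : measurable_fun setT h.
  apply: measurable_funM; apply: measurable_prod => j _; last exact: mind.
  exact: measurableT_comp.
have h0 w : (0 <= h w)%R.
  by rewrite mulr_ge0// prodr_ge0.
pose c : R := (\prod_(i <- r1) p i * \prod_(i <- r2) fine (P (X i @^-1` A i)))%R.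
have p0 j : (0 <= p j)%R.
  by rewrite -lee_fin -fp integral_ge0// => w _; rewrite lee_fin.
have c0 : (0 <= c)%R.
  by rewrite mulr_ge0 ?prodr_ge0// => j _; rewrite fine_ge0.
(* The weight [h] of the other factors is replaced by its mean [c]. It suffices to test this on
   indicators of [X i], which is the induction hypothesis with [i] moved to [r2]. *)
transitivity (\int[P]_w (f i (X i w) * c)%:E).
  under eq_integral do rewrite big_cons -mulrA.
  apply: (@ge0_integral_weight_ext _ _ _ _ _ _ _ P P (X i) (X i) h (cst c)) => //.
  move=> B mB.
  have := IH (i :: r2) (fun j => if j == i then B else A j).
  rewrite !big_cons eqxx => IHi.
  transitivity (fine (P (X i @^-1` B)) * c)%:E.
    rewrite /c mulrCA.
    have E2 (F : I -> set R -> R) : (\prod_(j <- r2) F j (if j == i then B else A j) =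
         \prod_(j <- r2) F j (A j))%R.
      by apply: eq_big_seq => j jr2; case: eqP => // ji; rewrite -ji jr2 in ir2.
    rewrite -(E2 (fun j C => fine (P (X j @^-1` C)))) -IHi.
    - apply: eq_integral => w _; rewrite /h big_cons eqxx.
      by rewrite (E2 (fun j C => \1_C (X j w))) mulrCA.
    - by move=> j; case: ifP.
    - by rewrite uniq_catC cat_cons cons_uniq uniq_catC ur12 mem_cat negb_or ir1 ir2.
  rewrite EFinM fineK ?fin_num_measure//; last first.
    by rewrite -[X in measurable X]setTI; exact: measurable_funP.
  under eq_integral do rewrite EFinM /=.
  rewrite ge0_integralZr//.
  - rewrite -[in LHS](setIT (_ @^-1` _)) -integral_indic//.
    by rewrite -[X in measurable X]setTI; exact: measurable_funP.
  - by apply/measurable_EFinP; exact: mind.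
under eq_integral do rewrite EFinM.
rewrite ge0_integralZr//.
- by rewrite fp big_cons -!EFinM mulrA.
- by apply/measurable_EFinP; exact: measurableT_comp.
- by move=> w _; rewrite lee_fin.
Qed.
End independence.

(** * Gaussian integrals and likelihood ratios *)

Section gaussian.
Context (R : realType).
Local Notation mu := (@lebesgue_measure R).

Lemma lebesgue_measure_shift (b : R) (A : set R) : measurable A ->
  mu A = pushforward mu (fun x : measurableTypeR R => x + b : measurableTypeR R) A.
Proof.
have mb : measurable_fun setT (fun x : measurableTypeR R => x + b : measurableTypeR R).
  exact: measurable_funD.
move=> mA.
apply: (@lebesgue_measure_unique R (pushforward mu (HB.pack_for {mfun _ >-> _}
  (fun x : measurableTypeR R => x + b : measurableTypeR R)
  (isMeasurableFun.Build _ _ _ _ _ mb)))) => //= _ [[x y]] _ <-.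
rewrite /pushforward/=.
have -> : (fun u : R => u + b) @^-1` `]x, y]%classic = `]x - b, y - b]%classic.
  by apply/seteqP; split => u /=; rewrite !in_itv/= ltrBlDr lerBrDr.
rewrite !lebesgue_measure_itv/= !lte_fin ltrD2r.
by case: ifP => // _; congr (_%:E); ring.
Qed.

Lemma ge0_integral_shift (b : R) (f : R -> R) : measurable_fun setT f ->
  (forall x, 0 <= f x) ->
  (\int[mu]_x (f x)%:E = \int[mu]_x (f (x + b))%:E)%E.
Proof.
move=> mf f0.
have mb : measurable_fun setT (fun x : measurableTypeR R => x + b : measurableTypeR R).
  exact: measurable_funD.
under eq_integral do rewrite -(mulr1 (f _)).
under [RHS]eq_integral do rewrite -(mulr1 (f _)).
apply: (@ge0_integral_weight_ext _ _ _ (measurableTypeR R) (measurableTypeR R)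
  (measurableTypeR R) R mu mu id (fun x => x + b) (cst 1) (cst 1)) => // B mB.
under eq_integral do rewrite mulr1.
under [RHS]eq_integral do rewrite mulr1.
rewrite integral_indic// setIT [LHS](lebesgue_measure_shift b mB).
rewrite /pushforward -[in LHS](setIT (_ @^-1` _)) -integral_indic//.
by rewrite -[X in measurable X]setTI; apply: mb.
Qed.

Lemma normal_pdf_expR (a x : R) :
  expR (a * x) * normal_pdf 0 1 x = expR (a ^+ 2 / 2) * normal_pdf a 1 x.
Proof.
rewrite !normal_pdfE ?oner_neq0// mulrCA [RHS]mulrCA; congr (_ * _).
by rewrite /normal_fun -!expRD; congr expR; field.
Qed.

(** Completing the square. Integrated, this is the Laplace transform of a noncentral chi-square
    variable with one degree of freedom. *)
Lemma normal_pdf_expR_sqr (a c x : R) : c < 1 / 2 ->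
  expR (c * (a + x) ^+ 2) * normal_pdf 0 1 x =
  (Num.sqrt (1 - 2 * c))^-1 * expR (c * a ^+ 2 / (1 - 2 * c)) *
  normal_pdf (2 * c * a / (1 - 2 * c)) (Num.sqrt (1 - 2 * c))^-1 x.
Proof.
move=> c2; have d0 : 0 < 1 - 2 * c by lra.
have s0 : 0 < Num.sqrt (1 - 2 * c) by rewrite sqrtr_gt0.
rewrite !normal_pdfE ?oner_neq0 ?invr_eq0 ?gt_eqF//.
rewrite /normal_peak /normal_fun exprVn sqr_sqrtr ?(ltW d0)//.
have -> : Num.sqrt ((1 - 2 * c)^-1 * pi *+ 2) = (Num.sqrt (1 - 2 * c))^-1 * Num.sqrt (pi *+ 2) :> R.
  rewrite -mulrnAr sqrtrM ?invr_ge0 ?(ltW d0)//; congr (_ * _).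
  by rewrite sqrtrV// ltW.
rewrite expr1n mul1r invfM invrK.
have e1 : (Num.sqrt (1 - 2 * c))^-1 * Num.sqrt (1 - 2 * c) = 1.
  by rewrite mulVf// gt_eqF.
set Q := (Num.sqrt (pi *+ 2))^-1; set S := Num.sqrt (1 - 2 * c) in e1 *.
set A := expR _; set B := expR _; set C := expR _; set D := expR _.
have ABCD : A * B = C * D.
  by rewrite /A /B /C /D -!expRD; congr expR; field; rewrite gt_eqF.
transitivity (Q * (A * B)); first by ring.
rewrite ABCD; transitivity (Q * (C * D) * (S^-1 * S)); first by rewrite e1 mulr1.
by ring.
Qed.

Context d (T : measurableType d) (P : probability T R) (X : {RV P >-> R}).
Hypothesis normalX : forall A : set R, measurable A ->
  distribution P X A = normal_prob 0 1 A.

Lemma ge0_expectation_normal (f : R -> R) : measurable_fun setT f ->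
  (forall x, 0 <= f x) ->
  (\int[P]_w (f (X w))%:E = \int[mu]_x (f x * normal_pdf 0 1 x)%:E)%E.
Proof.
move=> mf f0; under eq_integral do rewrite -(mulr1 (f _)).
apply: (@ge0_integral_weight_ext _ _ _ T (measurableTypeR R)
  R R P mu X id (cst 1) (normal_pdf 0 1)) => //.
- exact: measurable_normal_pdf.
- exact: normal_pdf_ge0.
move=> B mB.
under eq_integral do rewrite mulr1.
rewrite -[LHS](_ : P (X @^-1` B) = _); last first.
  rewrite -[in LHS](setIT (_ @^-1` _)) -integral_indic//.
  by rewrite -[X in measurable X]setTI; exact: measurable_funP.
have := normalX mB; rewrite /distribution /pushforward => ->.
rewrite /normal_prob [LHS]integral_mkcond; apply: eq_integral => x _.
rewrite patchE indicE; case: ifPn => xB; first by rewrite mul1r.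
by rewrite mul0r.
Qed.

Lemma expectation_normal_expR_sqr (a c : R) : c < 1 / 2 ->
  (\int[P]_w (expR (c * (a + X w) ^+ 2))%:E =
   ((Num.sqrt (1 - 2 * c))^-1 * expR (c * a ^+ 2 / (1 - 2 * c)))%:E)%E.
Proof.
move=> c2.
rewrite (ge0_expectation_normal (f := fun x => expR (c * (a + x) ^+ 2))); last 2 first.
- apply: measurableT_comp => //; apply: measurable_funM => //.
  by apply: measurable_funX; exact: measurable_funD.
- by move=> x; exact: expR_ge0.
under eq_integral do rewrite normal_pdf_expR_sqr// EFinM.
rewrite ge0_integralZl_EFin//; last 2 first.
- by move=> x _; rewrite lee_fin normal_pdf_ge0.
- by apply/measurable_EFinP; exact: measurable_normal_pdf.
by rewrite integral_normal_pdf mule1.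
Qed.

Lemma expectation_normal_expR (a : R) :
  (\int[P]_w (expR (a * X w))%:E = (expR (a ^+ 2 / 2))%:E)%E.
Proof.
rewrite (ge0_expectation_normal (f := fun x => expR (a * x))); last 2 first.
- by apply: measurableT_comp => //; exact: measurable_funM.
- by move=> x; exact: expR_ge0.
under eq_integral do rewrite normal_pdf_expR// EFinM.
rewrite ge0_integralZl_EFin//; last 2 first.
- by move=> x _; rewrite lee_fin normal_pdf_ge0.
- by apply/measurable_EFinP; exact: measurable_normal_pdf.
by rewrite integral_normal_pdf mule1.
Qed.

(** One-dimensional Cameron-Martin formula: [expR (a * x - a ^+ 2 / 2)] is the density of N(a, 1)
    with respect to N(0, 1). *)
Lemma normal_exponential_tilt (a : R) (f : R -> R) : measurable_fun setT f ->
  (forall x, 0 <= f x) ->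
  (\int[P]_w (expR (a * X w - a ^+ 2 / 2) * f (X w))%:E =
   \int[P]_w (f (X w + a))%:E)%E.
Proof.
move=> mf f0.
have ma : measurable_fun setT (fun x : measurableTypeR R => x + a : measurableTypeR R).
  exact: measurable_funD.
rewrite (ge0_expectation_normal (f := fun x => expR (a * x - a ^+ 2 / 2) * f x)); last 2 first.
- apply: measurable_funM => //; apply: measurableT_comp => //.
  by apply: measurable_funB => //; exact: measurable_funM.
- by move=> x; rewrite mulr_ge0// expR_ge0.
rewrite (ge0_expectation_normal (f := fun x => f (x + a))) => //; last first.
  exact: (measurableT_comp mf ma).
rewrite (ge0_integral_shift a).
- apply: eq_integral => x _; congr (_%:E).
  rewrite mulrAC [RHS]mulrC; congr (_ * _).
  rewrite !normal_pdfE ?oner_neq0// mulrCA; congr (_ * _).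
  by rewrite /normal_fun -expRD; congr expR; field.
- apply: measurable_funM; last exact: measurable_normal_pdf.
  apply: measurable_funM => //; apply: measurableT_comp => //.
  by apply: measurable_funB => //; exact: measurable_funM.
- by move=> x; rewrite !mulr_ge0 ?normal_pdf_ge0// expR_ge0.
Qed.
End gaussian.

(** * Chernoff bounds for the energy statistic *)

Section chernoff.
Variables (R : realType) (d : nat) (W : white_noise R d).
Local Notation P := (wn_prob W).
Local Notation xi := (wn_xi W).

Lemma expectation_expR_sum_sqr (r : seq (freq d)) (a : freq d -> R) (c : R) :
  uniq r -> c < 1 / 2 ->
  (\int[P]_w (expR (\sum_(k <- r) c * (a k + xi k w) ^+ 2))%:E =
   (((Num.sqrt (1 - 2 * c))^-1) ^+ size r *
     expR (c / (1 - 2 * c) * \sum_(k <- r) a k ^+ 2))%:E)%E.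
Proof.
move=> ur c2.
under eq_integral do rewrite expR_sum.
rewrite (@mutually_independent_expectation_prod _ _ _ P _ xi r
  (fun k x => expR (c * (a k + x) ^+ 2))
  (fun k => (Num.sqrt (1 - 2 * c))^-1 * expR (c * a k ^+ 2 / (1 - 2 * c)))) //.
- congr (_%:E); rewrite big_split/= big_const_seq count_predT iter_mulr_1; congr (_ * _).
  rewrite -expR_sum mulr_sumr; congr expR; apply: eq_bigr => k _.
  by rewrite mulrAC.
- exact: wn_indep.
- move=> k; apply: measurableT_comp => //; apply: measurable_funM => //.
  by apply: measurable_funX; exact: measurable_funD.
- move=> k; apply: (expectation_normal_expR_sqr (X := xi k)) => // A mA.
  exact: wn_gaussian.
Qed.

(** Markov's inequality for the exponential. Since [c] may have either sign, both tails are covered;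
    [B] stands for any upper bound of [- ln (1 - 2 * c) / 2]. *)
Lemma probability_le_expR (E : set (wn_space W)) (r : seq (freq d))
    (a : freq d -> R) (c b B : R) :
  measurable E -> uniq r -> c < 1 / 2 -> (Num.sqrt (1 - 2 * c))^-1 <= expR B ->
  (forall w, E w -> b <= \sum_(k <- r) c * (a k + xi k w) ^+ 2) ->
  (P E <= (expR ((size r)%:R * B + c / (1 - 2 * c) * (\sum_(k <- r) a k ^+ 2) - b))%:E)%E.
Proof.
move=> mE ur c2 cB Eb.
have mS : measurable_fun setT (fun w => expR (\sum_(k <- r) c * (a k + xi k w) ^+ 2)).
  apply: measurableT_comp => //; apply: measurable_sum => k.
  apply: measurable_funM => //; apply: measurable_funX.
  exact: measurable_funD.
apply: (@le_trans _ _ ((expR (- b))%:E *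
  \int[P]_w (expR (\sum_(k <- r) c * (a k + xi k w) ^+ 2))%:E)%E).
  rewrite -ge0_integralZl//; last exact/measurable_EFinP.
  rewrite -[leLHS](_ : (\int[P]_w (\1_E w)%:E)%E = _); last by rewrite integral_indic// setIT.
  apply: ge0_le_integral => //=.
  - exact/measurable_EFinP/measurable_indic.
  - by apply: emeasurable_funM => //; exact/measurable_EFinP.
  move=> w _; rewrite -EFinM lee_fin indicE; case: (boolP (w \in E)).
    rewrite inE => /Eb Ew; rewrite -expRD -expR0 ler_expR addrC subr_ge0//.
  by rewrite mulr_ge0 ?expR_ge0.
rewrite expectation_expR_sum_sqr// -EFinM lee_fin.
rewrite mulrC expRD ler_wpM2r ?expR_ge0// expRD ler_wpM2r ?expR_ge0//.
rewrite expRM_natl lerXn2r// nnegrE ?expR_ge0// invr_ge0//.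
Qed.

(** [1 + 2 * B <= expR (2 * B)] reduces the logarithmic bound to a polynomial inequality. *)
Lemma invsqrt_le_expR (l B : R) : 0 < 1 - 2 * l ->
  1 <= (1 - 2 * l) * (1 + 2 * B) -> (Num.sqrt (1 - 2 * l))^-1 <= expR B.
Proof.
move=> d0 h.
rewrite -(@ler_pXn2r _ 2) ?nnegrE ?invr_ge0 ?expR_ge0//.
rewrite exprVn sqr_sqrtr ?(ltW d0)// -expRM_natl.
apply: le_trans (expR_ge1Dx _).
by rewrite -[leLHS]mulr1 ler_pdivrMl.
Qed.

Variables (n : nat) (th : freq d -> R) (r : seq (freq d)) (kappa l : R).


Definition noisy (th : freq d -> R) (w : wn_space W) (k : freq d) : R :=
  th k + (Num.sqrt n%:R)^-1 * xi k w.

(** Subtracting the noise variance [n%:R^-1] makes this an unbiased estimator of the energy of the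
    signal on [r]. *)
Definition energy_stat (r : seq (freq d)) (y : freq d -> R) : R :=
  \sum_(k <- r) (y k ^+ 2 - n%:R^-1).

Lemma energy_statE w : (0 < n)%N -> n%:R * energy_stat r (noisy th w) =
  \sum_(k <- r) (Num.sqrt n%:R * th k + xi k w) ^+ 2 - (size r)%:R.
Proof.
move=> n_gt0; have n0 : 0 < n%:R :> R by rewrite ltr0n.
rewrite /energy_stat sumrB mulrBr; congr (_ - _); last first.
  by rewrite big_const_seq count_predT iter_addr_0 -[_^-1 *+ _]mulr_natr mulrA divff ?mul1r// gt_eqF.
rewrite mulr_sumr; apply: eq_bigr => k _.
rewrite -[in LHS](sqr_sqrtr (ltW n0)) -exprMn; congr (_ ^+ 2).
by rewrite /noisy mulrDr mulVKf// gt_eqF// sqrtr_gt0.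
Qed.

Lemma measurable_energy_stat :
  measurable_fun setT (fun w => energy_stat r (noisy th w)).
Proof.
apply: measurable_sum => k; apply: measurable_funB => //.
by apply: measurable_funX; apply: measurable_funD => //; exact: measurable_funM.
Qed.

(** With N = [size r] the Chernoff exponent is [4 N l^2 - l n kappa / 4], and [48 N l <= n kappa]
    keeps the quadratic part below a third of the linear one. *)
Lemma energy_stat_false_positive :
  (0 < n)%N -> uniq r -> 0 <= l -> l <= 1 / 4 -> 0 <= kappa ->
  48 * (size r)%:R * l <= n%:R * kappa -> (forall k, k \in r -> th k = 0) ->
  (P [set w | kappa / 4 <= energy_stat r (noisy th w)]%R
     <= (expR (- (l * n%:R * kappa / 24)))%:E)%E.
Proof.
move=> n_gt0 ur l_ge0 l_le kappa_ge0 rl th0; have n0 : 0 < n%:R :> R by rewrite ltr0n.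
apply: le_trans.
  (* The choice of B works because [(1 - 2 l) (1 + 2 l + 8 l^2) = 1 + 4 l^2 (1 - 4 l)], at least 1
     for [l <= 1/4]. *)
  apply: (@probability_le_expR _ r (fun k => Num.sqrt n%:R * th k) l
    (l * ((size r)%:R + n%:R * (kappa / 4))) (l + 4 * l ^+ 2)) => //.

  - have := @measurable_energy_stat measurableT _ (measurable_itv `[kappa / 4, +oo[).
    by rewrite setTI; congr measurable; apply/seteqP; split => w /=; rewrite in_itv/= andbT.
  - by move: l_le; lra.
  - by apply: invsqrt_le_expR; move: l_le l_ge0; [lra|nra].
  - move=> w /= hw; rewrite -mulr_sumr ler_wpM2l//.
    by rewrite -lerBrDl -energy_statE// ler_wpM2l// ltW.
rewrite lee_fin ler_expR big_seq big1 ?mulr0 ?addr0; last first.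
  by move=> k /th0 ->; rewrite mulr0 expr0n.
have : 0 <= n%:R * kappa by rewrite mulr_ge0// ltW.
set N := (size r)%:R in rl *; set m := n%:R * kappa => m0.
have N0 : 0 <= N by [].
have -> : l * n%:R * kappa / 24 = l * m / 24 by rewrite /m; ring.
have lm : 0 <= l * (m - 48 * N * l) by rewrite mulr_ge0// subr_ge0.
rewrite (mulrA n%:R) -/m; nra.
Qed.

(** The lower tail fixes the constants: the exponent is [2 N l^2 - l V / (1 + 2 l) + l n kappa / 4]
    with [V >= n kappa / 2] and [1 + 2 l <= 3/2], hence at most [(1/24 - 1/3 + 1/4) l n kappa = - l
    n kappa / 24]. *)
Lemma energy_stat_false_negative :
  (0 < n)%N -> uniq r -> 0 <= l -> l <= 1 / 4 -> 0 <= kappa ->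
  48 * (size r)%:R * l <= n%:R * kappa ->
  kappa / 2 <= \sum_(k <- r) th k ^+ 2 ->
  (P [set w | energy_stat r (noisy th w) < kappa / 4]%R
     <= (expR (- (l * n%:R * kappa / 24)))%:E)%E.
Proof.
move=> n_gt0 ur l_ge0 l_le kappa_ge0 rl thk; have n0 : 0 < n%:R :> R by rewrite ltr0n.
apply: le_trans.
  (* Here [(1 + 2 l) (1 - 2 l + 4 l^2) = 1 + 8 l^3]. *)
  apply: (@probability_le_expR _ r (fun k => Num.sqrt n%:R * th k) (- l)
    (- (l * ((size r)%:R + n%:R * (kappa / 4)))) (- l + 2 * l ^+ 2)) => //.
  - have := @measurable_energy_stat measurableT _ (measurable_itv `]-oo, kappa / 4[).
    by rewrite setTI; congr measurable; apply/seteqP; split => w /=; rewrite in_itv/=.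
  - by move: l_ge0; lra.
  - by apply: invsqrt_le_expR; move: l_le l_ge0; [lra|nra].
  - move=> w /= hw; rewrite -mulr_sumr mulNr lerN2 ler_wpM2l//.
    by rewrite -lerBlDl -energy_statE// ler_wpM2l// ltW.
rewrite lee_fin ler_expR.
have -> : \sum_(k <- r) (Num.sqrt n%:R * th k) ^+ 2 = n%:R * \sum_(k <- r) th k ^+ 2.
  by rewrite mulr_sumr; apply: eq_bigr => k _; rewrite exprMn sqr_sqrtr// ltW.
have : 0 <= n%:R * kappa by rewrite mulr_ge0// ltW.
have : n%:R * kappa / 2 <= n%:R * \sum_(k <- r) th k ^+ 2.
  by rewrite -mulrA ler_wpM2l// ltW.
set V := n%:R * \sum_(_ <- _) _; set N := (size r)%:R in rl *.
set m := n%:R * kappa => mV m0.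
have N0 : 0 <= N by [].
have -> : l * n%:R * kappa / 24 = l * m / 24 by rewrite /m; ring.
have d0 : 0 < 1 + 2 * l by lra.
have : - l / (1 - 2 * - l) * V <= - (l * m / 3).
  rewrite mulrN opprK mulrAC !mulNr lerN2 ler_pdivlMr//.
  have : 0 <= l * (V - m / 2) by rewrite mulr_ge0// subr_ge0.
  have : 0 <= (l * m) * (1 / 4 - l) by rewrite !mulr_ge0// subr_ge0.
  by lra.
have lm' : 0 <= l * (m - 48 * N * l) by rewrite mulr_ge0// subr_ge0.
rewrite (mulrA n%:R) -/m; nra.
Qed.

End chernoff.

(** * Cameron-Martin formula for the white noise *)

Section tilting.
Local Open Scope ereal_scope.
Variables (R : realType) (d : nat) (W : white_noise R d).
Local Notation P := (wn_prob W).
Local Notation xi := (wn_xi W).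
Local Notation coordinate_events :=
  [set (fun y : freq d -> R => y k) @^-1` B
     | k in [set: freq d] & B in (measurable : set (set R))].

(** The coordinate events are not stable under intersection. The finite-dimensional rectangles are,
    they generate the same events, and the tilt factorises on them. *)
Let rectangles : set (set (freq d -> R)) :=
  [set A | exists r : seq (freq d), exists B : freq d -> set R,
     [/\ forall k, measurable (B k), forall k, k \notin r -> B k = setT
       & A = [set y | forall k, B k (y k)]] ].

Let coordinate_rectangles : <<s coordinate_events >> `<=` <<s rectangles >>.
Proof.
apply: smallest_sub; first exact: smallest_sigma_algebra.
move=> A [k _ [B mB <-]]; apply: sub_sigma_algebra.
exists [:: k], (fun j => if j == k then B else setT); split.
- by move=> j; case: ifP.
- by move=> j; rewrite inE => /negbTE ->.
- apply/seteqP; split => y /=; last by move/(_ k); rewrite eqxx.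
  by move=> By j; case: eqP => // ->.
Qed.

Let rectanglesI : setI_closed rectangles.
Proof.
move=> _ _ [r1 [B1 [mB1 B1T ->]]] [r2 [B2 [mB2 B2T ->]]].
exists (r1 ++ r2), (fun k => B1 k `&` B2 k); split.
- by move=> k; exact: measurableI.
- by move=> k; rewrite mem_cat negb_or => /andP[/B1T -> /B2T ->]; rewrite setTI.
- by apply/seteqP; split => y /= => [[h1 h2] k|h]; [split|split=> k; have [] := h k].
Qed.

Let mY (Y : wn_space W -> freq d -> R) :
  (forall k, measurable_fun setT (fun w => Y w k)) ->
  forall S, <<s rectangles >> S -> measurable (Y @^-1` S).
Proof.
move=> mYk.
suff : <<s rectangles >> `<=` [set S | measurable (Y @^-1` S)] by [].
apply: smallest_sub.
  split => /=.
  - by rewrite preimage_set0.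
  - by move=> A mA; rewrite setTD preimage_setC; exact: measurableC.
  - by move=> F mF; rewrite preimage_bigcup; exact: bigcupT_measurable.
move=> _ [r [B [mB BT ->]]] /=.
have -> : Y @^-1` [set y | forall k, B k (y k)] =
    \bigcap_(k in [set` r]) ((fun w => Y w k) @^-1` B k).
  apply/seteqP; split => w /= h k; first by move=> _; exact: h.
  by have [/h//|/BT ->] := boolP (k \in r).
apply: fin_bigcap_measurable => [|k _]; first exact: finite_seq.
by rewrite -[X in measurable X]setTI; exact: mYk.
Qed.

Variables (s : R) (K : seq (freq d)) (a : freq d -> R).
Hypotheses (uK : uniq K) (aK : forall k, k \notin K -> a k = 0%R).

(** The density of the law of [xi + a] with respect to that of [xi]; [a] vanishes off [K]. *)
Definition likelihood (w : wn_space W) : R :=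
  (\prod_(k <- K) expR (a k * xi k w - a k ^+ 2 / 2))%R.

Lemma likelihood_ge0 w : (0 <= likelihood w)%R.
Proof. by apply: prodr_ge0. Qed.

Lemma measurable_likelihood : measurable_fun setT likelihood.
Proof.
apply: measurable_prod => k _; apply: measurableT_comp => //.
by apply: measurable_funB => //; exact: measurable_funM.
Qed.

Let Y1 w k := (s * xi k w)%R.
Let Y2 w k := (s * (xi k w + a k))%R.

Let mY1 k : measurable_fun setT (fun w => Y1 w k).
Proof. exact: measurable_funM. Qed.
Let mY2 k : measurable_fun setT (fun w => Y2 w k).
Proof. by apply: measurable_funM => //; exact: measurable_funD. Qed.

Let mB_xi k (B : set R) (c : R) : measurable B ->
  measurable (wn_xi W k @^-1` [set x | B (s * (x + c))%R]).
Proof.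
move=> mB; rewrite -[X in measurable X]setTI.
have : measurable_fun setT (fun w => s * (xi k w + c))%R.
  by apply: measurable_funM => //; exact: measurable_funD.
by move=> /(_ measurableT _ mB).
Qed.

(** By independence, one normal tilt per coordinate of [K ++ r]: off [K] the density is 1 since [a]
    vanishes, off [r] the constraint is [setT]. *)
Let rectangle_tilt S : rectangles S ->
  \int[P]_(w in Y1 @^-1` S) (likelihood w)%:E = P (Y2 @^-1` S).
Proof.
move=> [r [B [mB BT ->]]].
pose f k (x : R) : R := (expR (a k * x - a k ^+ 2 / 2) * \1_(B k) (s * x))%R.
pose rK := undup (K ++ r).
have mind k c : measurable_fun setT (fun x : R => \1_(B k) (s * (x + c)) : R)%R.
  apply: measurableT_comp; first exact: measurable_indic.
  by apply: measurable_funM => //; exact: measurable_funD.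
transitivity (\int[P]_w (\prod_(k <- rK) f k (xi k w))%:E).
  rewrite integral_mkcond; apply: eq_integral => w _; rewrite patchE.
  have -> : (\prod_(k <- rK) f k (xi k w) =
      likelihood w * \prod_(k <- rK) \1_(B k) (s * xi k w))%R.
    rewrite big_split/=; congr (_ * _)%R.
    rewrite (bigID (mem K))/= [X in (_ * X)%R]big1 ?mulr1; last first.
      by move=> k /aK ->; rewrite mul0r expr0n/= mul0r subr0 expR0.
    rewrite -big_filter; apply: perm_big; apply: uniq_perm => //.
      by rewrite filter_uniq// undup_uniq.
    move=> k; rewrite mem_filter mem_undup mem_cat.
    by case: (k \in K).
  case: ifPn => [|]; rewrite ?inE ?notin_setE/=.
    by move=> hB; rewrite big1 ?mulr1// => k _; rewrite indicE mem_set//; exact: hB.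
  move=> /existsNP[k nBk]; rewrite (big_rem k)//=; last first.
    rewrite mem_undup mem_cat; apply/orP; right.
    by apply: contraPT nBk => /BT ->; apply.
  by rewrite indicE memNset// mul0r mulr0.
have PB k : measurable (wn_xi W k @^-1` [set x | B k (s * (x + a k))%R]).
  exact: mB_xi.
rewrite (@mutually_independent_expectation_prod _ _ _ P _ xi rK f
  (fun k => fine (P (wn_xi W k @^-1` [set x | B k (s * (x + a k))%R])))) //.
- rewrite (big_morph _ EFinM (erefl _)).
  under eq_bigr do rewrite fineK ?fin_num_measure//.
  rewrite -(@wn_indep _ _ W rK _ (fun k => [set x | B k (s * (x + a k))%R])) ?undup_uniq//; last first.
    move=> k; rewrite -[X in measurable X]setTI.
    have : measurable_fun setT (fun x : R => s * (x + a k))%R.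
      by apply: measurable_funM => //; exact: measurable_funD.
    by move=> /(_ measurableT _ (mB k)).
  congr (P _); apply/seteqP; split => w /= h k; last by move=> _; exact: h.
  have [/h//|] := boolP (k \in rK).
  by rewrite mem_undup mem_cat negb_or => /andP[_ /BT ->].

- exact: wn_indep.
- exact: undup_uniq.
- move=> k; rewrite /f; apply: measurable_funM; last first.
    by have := mind k 0%R; under eq_fun do rewrite addr0.
  by apply: measurableT_comp => //; apply: measurable_funB.
- by move=> k x; rewrite /f mulr_ge0 ?expR_ge0.
- move=> k; rewrite /f.
  rewrite (normal_exponential_tilt (X := xi k) _ (a k) (f := fun x => \1_(B k) (s * x)))%R //.
  + rewrite fineK ?fin_num_measure// -[X in _ = P X]setIT -integral_indic//.
  + by move=> A mA; exact: wn_gaussian.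
  + by have := mind k 0%R; under eq_fun do rewrite addr0.
Qed.

(* Cameron-Martin formula for a shift supported by finitely many coordinates. *)
Lemma exponential_tilt (A : set (freq d -> R)) : <<s coordinate_events >> A ->
  \int[P]_(w in [set w | A (fun k => s * xi k w)%R]) (likelihood w)%:E =
  P [set w | A (fun k => s * (xi k w + a k))%R].
Proof.
move=> /coordinate_rectangles.
pose T : measurableType rectangles.-sigma := g_sigma_algebraType rectangles.
(* Total mass 1: complements in the Dynkin class are handled by subtracting from it. *)
have cT : \int[P]_(w in Y1 @^-1` setT) (likelihood w)%:E = 1.
  rewrite rectangle_tilt ?preimage_setT ?probability_setT//.
  by exists [::], (fun=> setT); split => //; apply/seteqP; split.
apply: (@dynkin_induction _ T rectangles (fun S =>
  \int[P]_(w in Y1 @^-1` S) (likelihood w)%:E = P (Y2 @^-1` S))) => //.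
- by rewrite cT preimage_setT probability_setT.
- move=> S mS hS.
  have m1 := mY mY1 mS; have m2 := mY mY2 mS.
  have := cT; rewrite preimage_setT -(setUv (Y1 @^-1` S)) ge0_integral_setU//=.
  + rewrite hS -!preimage_setC probability_setC// => h.
    rewrite -h [X in _ = X - _]addeC addeK// fin_num_measure//.
  + exact: measurableC.
  + by rewrite setUv; apply/measurable_EFinP; exact: measurable_likelihood.
  + by move=> w _; rewrite lee_fin likelihood_ge0.
  + by rewrite disj_set2E setICr.
- move=> F mF tF hF.
  rewrite !preimage_bigcup ge0_integral_bigcup//=.
  + have mF2 k : measurable (Y2 @^-1` F k) by apply: mY mY2 _ (mF k).
    rewrite measure_semi_bigcup//=.
    * by apply: eq_eseriesr => k _; exact: hF.
    * by move=> i j _ _ [w [Fi Fj]]; apply: tF => //; eexists; split; [exact: Fi|exact: Fj].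
    * exact: bigcupT_measurable.
  + by move=> k; apply: mY mY1 _ (mF k).
  + by apply/measurable_EFinP/measurable_funTS; exact: measurable_likelihood.
  + by move=> w _; rewrite lee_fin likelihood_ge0.
  + by move=> i j _ _ [w [Fi Fj]]; apply: tF => //; eexists; split; [exact: Fi|exact: Fj].
Qed.
End tilting.

(** * Fourier coefficients on the cube *)

Section fourier_basis.
Context (R : realType).
Local Notation mu := (@lebesgue_measure R).
Local Notation U := (uniform_prob (@ltr01 R)).
Local Notation cubem := (cube_measure R).

Lemma measurable_cube d : measurable (@cube R d).
Proof.
rewrite (_ : @cube R d = \bigcap_(i in [set: 'I_d])
    ((fun x : point R d => tnth x i) @^-1` `[0, 1]%classic)); last first.
  apply/seteqP; split => x h i; first by move=> _; rewrite /= in_itv/=; exact: h.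
  by have := h i I; rewrite /= in_itv.
apply: fin_bigcap_measurable => [|i _]; first exact: finite_finset.
by rewrite -[X in measurable X]setTI; apply: measurable_tnth.
Qed.

Lemma cube_measure_cube d : cubem d (@cube R d) = 1%E.
Proof.
elim: d => [|d IH] /=.
  by rewrite diracE mem_set// => -[].
rewrite /distribution /pushforward.
rewrite (_ : _ @^-1` _ = `[0, 1]%classic `*` @cube R d); last first.
  apply/seteqP; split => -[x0 x] /=; rewrite /cube /= in_itv/=.
    move=> h; split; first exact: (h ord0).
    by move=> i; have := h (lift ord0 i); rewrite tnthS.
  move=> [h0 h] i; case: (unliftP ord0 i) => [j ->|->]; last exact: h0.
  by rewrite tnthS; exact: h.
rewrite product_measure1E//; last exact: measurable_cube.
rewrite -[RHS]mule1; congr (_ * _)%E; last exact: IH.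
exact: (integral_uniform_pdf1 (@ltr01 R)).
Qed.

Lemma integral_uniform_prob (f : R -> R) : measurable_fun setT f ->
  (\int[U]_x (f x)%:E = \int[mu]_(x in `[0%R, 1%R]) (f x)%:E)%E.
Proof.
move=> mf; rewrite integralE [RHS]integralE; congr (_ - _)%E.
  rewrite integral_uniform//; first by rewrite subr0 invr1 mul1e.
  exact/measurable_funepos/measurable_EFinP.
rewrite integral_uniform//; first by rewrite subr0 invr1 mul1e.
exact/measurable_funeneg/measurable_EFinP.
Qed.

Lemma sinD2piint (b : R) (k : int) : sin (2 * pi * k%:~R + b) = sin b.
Proof.
have nat_case (n : nat) (c : R) : sin (c + 2 * pi * n%:R) = sin c.
  elim: n c => [|n IH] c; first by rewrite mulr0 addr0.
  by rewrite -[n.+1%:R]natr1 mulrDr mulr1 addrA mulr_natl sinD2pi -mulr_natl IH.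
case: k => n; first by rewrite addrC nat_case.
rewrite NegzE mulrNz mulrN addrC -(nat_case n.+1 (b - 2 * pi * n.+1%:R)).
by rewrite subrK.
Qed.

Lemma integral_uniform_cos (k : int) (b : R) : k != 0 ->
  (\int[U]_x (cos (2 * pi * (k%:~R * x) + b))%:E = 0)%E.
Proof.
move=> k0.
pose c : R := 2 * pi * k%:~R.
have c0 : c != 0.
  by rewrite !mulf_neq0 ?intr_eq0// gt_eqF// pi_gt0.
have mcos : measurable_fun setT (fun x : R => cos (2 * pi * (k%:~R * x) + b)).
  apply: measurableT_comp; first by apply: continuous_measurable_fun; exact: continuous_cos.
  by apply: measurable_funD => //; do 2 apply: measurable_funM.
apply: etrans (integral_uniform_prob mcos) _.
pose F (x : R) := c^-1 * sin (c * x + b).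
have dF (x : R) : is_derive x 1 F (cos (2 * pi * (k%:~R * x) + b)).
  apply: is_derive_eq; rewrite ?derive_id mulrA -/c.
  by rewrite addr0 /GRing.scale/=; field.
have cF : continuous F.
  by move=> x; apply: differentiable_continuous; apply/derivable1_diffP; case: (dF x).
rewrite (@continuous_FTC2 _ (fun x : R => cos (2 * pi * (k%:~R * x) + b)) F)//.
- rewrite /F mulr1 mulr0 add0r /c -[2 * pi * k%:~R]addr0 addr0 sinD2piint subee//.
- apply: continuous_subspaceT => x.
  apply: continuous_comp; last exact: continuous_cos.
  apply: cvgD; last exact: cvg_cst.
  apply: cvgM; first exact: cvg_cst.
  by apply: cvgM; [exact: cvg_cst|exact: cvg_id].
- split; first by move=> x _; case: (dF x).
  + by apply: cvg_at_right_filter; exact: cF.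
  + by apply: cvg_at_left_filter; exact: cF.
- by move=> x _; rewrite derive1E; case: (dF x).
Qed.

End fourier_basis.

Section fourier_orthogonality.
Context (R : realType).
Local Notation U := (uniform_prob (@ltr01 R)).
Local Notation cubem := (cube_measure R).
Local Open Scope ereal_scope.

Lemma integrable_cube_cons d (f : point R d.+1 -> \bar R) :
  (cubem d.+1).-integrable setT f ->
  (U \x cubem d).-integrable setT (fun p => f (@cons_point R d p)).
Proof.
move=> /integrableP[mf intf]; apply/integrableP; split.
  by apply: measurableT_comp => //; exact: measurable_cons_point.
move: intf; rewrite /= [X in X < _ -> _]ge0_integral_distribution//.
exact: measurableT_comp.
Qed.

Lemma integral_cube_cons d (f : point R d.+1 -> \bar R) :
  (cubem d.+1).-integrable setT f ->
  \int[cubem d.+1]_x f x = \int[U \x cubem d]_p f (@cons_point R d p).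
Proof.
move=> fi; rewrite /= [LHS]integral_distribution//.
- exact: (measurable_int (cubem d.+1)).
- exact: integrable_cube_cons fi.
Qed.

Lemma dot_cons d (k : freq d.+1) (x0 : R) (x : point R d) :
  (dot k (@cons_point R d (x0, x)) =
  (k ord0)%:~R * x0 + dot [ffun i => k (lift ord0 i)] x)%R.
Proof.
rewrite /dot big_ord_recl /=; congr (_ + _)%R.
by apply: eq_bigr => i _; rewrite ffunE tnthS.
Qed.

Lemma measurable_dot d (k : freq d) : measurable_fun setT (@dot R d k).
Proof.
apply: measurable_sum => j; apply: measurable_funM => //.
exact: measurable_tnth.
Qed.

Lemma measurable_cos_dot d (k : freq d) (b : R) :
  measurable_fun setT (fun x : point R d => cos (2 * pi * dot k x + b)%R).
Proof.
apply: measurableT_comp.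
  by apply: continuous_measurable_fun; exact: continuous_cos.
by apply: measurable_funD => //; apply: measurable_funM => //; exact: measurable_dot.
Qed.

Lemma integrable_mul_cos d (f : point R d -> R) (k : freq d) (b : R) :
  (cubem d).-integrable setT (EFin \o f) ->
  (cubem d).-integrable setT
    (fun x => (f x * cos (2 * pi * dot k x + b))%:E).
Proof.
move=> fi; apply: (integrableMl measurableT fi (measurable_cos_dot k b)).
exists 1%R; split => // M M1 x _ /=.
by rewrite (le_trans (cos_max _))// ltW.
Qed.

(** Integrate along coordinate [j] first: [f] is constant there and the cosine runs through whole
    periods. The induction follows the recursive product [cube_measure], and the phase [b] absorbs
    the coordinates already split off. *)
Lemma integral_mul_cos_eq0 d (k : freq d) (j : 'I_d) (b : R)
    (f : point R d -> R) :
  (k j != 0)%R -> (cubem d).-integrable setT (EFin \o f) ->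
  (forall x y, (forall i, i != j -> tnth x i = tnth y i) -> f x = f y) ->
  \int[cubem d]_x (f x * cos (2 * pi * dot k x + b))%:E = 0.
Proof.
elim: d => [|d IH] in k j b f *; first by case: j.
move=> kj fi fj.
have gi := integrable_mul_cos k b fi.
rewrite integral_cube_cons//.
have [j' jE|jE] := unliftP ord0 j; last first.
  rewrite -integral21_prod_meas1; last exact: integrable_cube_cons gi.
  rewrite integral0_eq// => y _; rewrite /fubini_G.
  transitivity (\int[U]_x ((f (@cons_point R d (0%R, y)))%:E *
      (cos (2 * pi * ((k ord0)%:~R * x) +
        (2 * pi * dot [ffun i => k (lift ord0 i)] y + b)))%:E)).
    apply: eq_integral => x _; rewrite EFinM; congr (_%:E * (cos _)%:E).
      apply: fj => i; case: (unliftP ord0 i) => [i' ->|->]; rewrite ?tnthS//.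
      by rewrite jE eqxx.
    by rewrite dot_cons; ring.
  rewrite integralZl//.
    by rewrite integral_uniform_cos ?mule0// -jE.
  apply: measurable_bounded_integrable => //=.
  - by rewrite -ge0_fin_numE ?fin_num_measure.
  - apply: measurableT_comp.
      by apply: continuous_measurable_fun; exact: continuous_cos.
    by apply: measurable_funD => //; do 2 apply: measurable_funM => //.
  - exists 1%R; split => // M M1 x _ /=.
    by rewrite (le_trans (cos_max _))// ltW.
rewrite -integral12_prod_meas1; last exact: integrable_cube_cons gi.
have fi' := integrable_cube_cons fi.
(* The induction hypothesis needs an integrable section of [f], available for almost every first
   coordinate only. *)
rewrite (ae_eq_integral (cst 0))//; first by rewrite integral_cst// mul0e.
  exact: measurable_fubini_F (integrable_cube_cons gi).
have := ae_integrable1 fi'; apply: filterS => x fxi _.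
rewrite /fubini_F /=.
have := IH [ffun i => k (lift ord0 i)] j'
  (2 * pi * ((k ord0)%:~R * x) + b)%R (fun y => f (@cons_point R d (x, y))).
rewrite ffunE -jE => /(_ kj fxi) <-.
  apply: eq_integral => y _; congr (_ * cos _)%:E.
  by rewrite dot_cons; ring.
move=> y z yz; apply: fj => i; case: (unliftP ord0 i) => [i' ->|->] //.
by rewrite jE !tnthS (inj_eq lift_inj) => /yz.
Qed.

End fourier_orthogonality.

Section trigonometric_polynomials.
Context (R : realType) (d : nat).
Local Notation cubem := (cube_measure R d).
Implicit Types (k l : freq d) (x : point R d).

(** [sin t = cos (t - pi / 2)]: every nonconstant basis function becomes a shifted cosine, and the
    sine case needs no separate treatment. *)
Definition phase k : R := if freq_pos k then 0 else - (pi / 2).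

Lemma fourier_phase k x : k != 0 ->
  fourier k x = Num.sqrt 2 * cos (2 * pi * dot k x + phase k).
Proof.
move=> k0; rewrite /fourier (negbTE k0) /phase; case: ifP => _.
  by rewrite addr0.
by rewrite cosBpihalf.
Qed.

Lemma measurable_fourier k : measurable_fun setT (@fourier R d k).
Proof.
have [->|k0] := eqVneq k 0.
  by rewrite (_ : fourier 0 = cst 1)//; apply/funext => x; rewrite /fourier eqxx.
rewrite (_ : fourier k = fun x => Num.sqrt 2 * cos (2 * pi * dot k x + phase k)); last first.
  by apply/funext => x; exact: fourier_phase.
by apply: measurable_funM => //; exact: measurable_cos_dot.
Qed.

Lemma fourier_bound k x : `|fourier k x| <= 2.
Proof.
have [->|k0] := eqVneq k 0; first by rewrite /fourier eqxx normr1 ler1n.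
rewrite fourier_phase// normrM ger0_norm ?sqrtr_ge0// -[leRHS]mulr1.
apply: ler_pM => //; last exact: cos_max.
rewrite -(@ler_pXn2r _ 2) ?nnegrE//.
by rewrite sqr_sqrtr//; lra.
Qed.

Lemma bounded_integrable_cube (f : point R d -> R) (M : R) :
  measurable_fun setT f -> (forall x, `|f x| <= M) ->
  cubem.-integrable setT (EFin \o f).
Proof.
move=> mf fM; apply: measurable_bounded_integrable => //.
  by rewrite -ge0_fin_numE ?fin_num_measure.
by exists M; split => [|N MN x _]; [exact: num_real|rewrite /= (le_trans (fM x))// ltW].
Qed.

Lemma Rintegral_cos_dot k (b : R) :
  \int[cubem]_x cos (2 * pi * dot k x + b) = if k == 0 then cos b else 0.
Proof.
have [->|k0] := eqVneq k 0.
  transitivity (\int[cubem]_(x in setT) cos b).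
    apply: eq_Rintegral => x _; rewrite /dot big1 ?mulr0 ?add0r//.
    by move=> i _; rewrite ffunE mul0r.
  by rewrite Rintegral_cst//= probability_setT mulr1.
have [j kj] : exists j, k j != 0.
  apply/existsP; apply: contraNT k0; rewrite negb_exists => /forallP k0.
  by apply/eqP/ffunP => j; rewrite ffunE; apply/eqP; have := k0 j; rewrite negbK.
rewrite /Rintegral -[RHS]/(fine 0); congr fine.
rewrite -[RHS](@integral_mul_cos_eq0 R d k j b (cst 1) kj)//.
  by apply: eq_integral => x _; rewrite /= mul1r.
by apply: (@bounded_integrable_cube _ 1) => // x; rewrite normr1.
Qed.

(** Both signs are read off at the same index, the first nonzero coordinate. *)
Lemma freq_posN k : k != 0 -> freq_pos (- k) = ~~ freq_pos k.
Proof.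
move=> k0.
have [j0 kj0] : exists j, k j != 0.
  apply/existsP; apply: contraNT k0; rewrite negb_exists => /forallP k0.
  by apply/eqP/ffunP => j; rewrite ffunE; apply/eqP; have := k0 j; rewrite negbK.
case: (@arg_minnP _ j0 (fun j => k j != 0) (fun j => j : nat) kj0) => j kj jmin.
have kE (l : freq d) : (forall i, (l i == 0) = (k i == 0)) -> freq_pos l = (0 < l j).
  move=> lk; apply/existsP/idP => [[i /andP[li /forallP hi]]|lj]; last first.
    exists j; rewrite lj; apply/forallP => i; apply/implyP => ij.
    rewrite lk; apply: contraTT ij => ki; rewrite -leqNgt; exact: jmin.
  have ij : i = j.
    apply/val_inj/eqP; rewrite eqn_leq jmin ?andbT; last by rewrite -lk gt_eqF.
    rewrite leqNgt; apply/negP => ji; have := hi j; rewrite ji lk /=.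
    by rewrite (negbTE kj).
  by rewrite -ij.
rewrite !kE//; last by move=> i; rewrite ffunE oppr_eq0.
by rewrite ffunE oppr_gt0 -leNgt le_eqVlt (negbTE kj).
Qed.

(** For nonzero [k] and [l], [2 cos A cos B = cos (A - B) + cos (A + B)], where a cosine survives
    integration only at frequency 0, that is for [k = l] or [k = - l]. *)
Lemma theta_fourier k l : theta (@fourier R d k) l = (k == l)%:R.
Proof.
rewrite /theta.
have icos m b : cubem.-integrable setT (fun x => (cos (2 * pi * dot m x + b))%:E).
  apply: (@bounded_integrable_cube _ 1); first exact: measurable_cos_dot.
  by move=> x; exact: cos_max.
have one m : m != 0 -> \int[cubem]_x (fourier m x) = 0.
  move=> m0; under eq_Rintegral do rewrite fourier_phase//.
  rewrite RintegralZl//=; last exact: icos.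
  by rewrite Rintegral_cos_dot (negbTE m0) mulr0.
have [->|k0] := eqVneq k 0.
  under eq_Rintegral do rewrite [X in X * _]/fourier eqxx mul1r.
  have [<-|l0] := eqVneq 0 l; last by rewrite one// eq_sym.
  under eq_Rintegral do rewrite /fourier eqxx.
  by rewrite Rintegral_cst//= probability_setT mulr1.
have [->|l0] := eqVneq l 0.
  under eq_Rintegral do rewrite [X in _ * X]/fourier eqxx mulr1.
  by rewrite one// (negbTE k0).
transitivity (\int[cubem]_x (cos (2 * pi * dot (k - l) x + (phase k - phase l)) +
    cos (2 * pi * dot (k + l) x + (phase k + phase l)))).
  apply: eq_Rintegral => x _; rewrite !fourier_phase//.
  have -> : 2 * pi * dot (k - l) x + (phase k - phase l) =
      (2 * pi * dot k x + phase k) - (2 * pi * dot l x + phase l).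
    suff -> : dot (k - l) x = dot k x - dot l x by ring.
    by rewrite /dot -sumrB; apply: eq_bigr => i _; rewrite !ffunE intrD mulrDl mulrNz mulNr.
  have -> : 2 * pi * dot (k + l) x + (phase k + phase l) =
      (2 * pi * dot k x + phase k) + (2 * pi * dot l x + phase l).
    suff -> : dot (k + l) x = dot k x + dot l x by ring.
    by rewrite /dot -big_split; apply: eq_bigr => i _; rewrite !ffunE intrD mulrDl.
  move: (_ + phase k) (_ + phase l) => A B.
  rewrite mulrACA -expr2 sqr_sqrtr// (cosB A B) (cosD A B); ring.
rewrite RintegralD//=; [|exact: icos|exact: icos].
rewrite !Rintegral_cos_dot subr_eq0 addr_eq0.
have [<-|kl] := eqVneq k l.
  rewrite subrr cos0 ifF ?addr0//; apply/negP => /eqP kNk.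
  case/eqP: k0; apply/ffunP => i; rewrite ffunE.
  move/ffunP: kNk => /(_ i); rewrite ffunE => /eqP.
  by rewrite -addr_eq0 -mulr2n mulrn_eq0 => /eqP.
(* For [k = - l] exactly one of the two is a sine; the phases add up to [- (pi / 2)], where the
   cosine vanishes. *)
case: eqP => [kNl|]; last by rewrite addr0.
rewrite add0r kNl /phase freq_posN//.
by case: (freq_pos l); rewrite /= ?addr0 ?add0r cosN cos_pihalf.
Qed.

Definition trig_poly (r : seq (freq d)) (c : freq d -> R) x : R :=
  \sum_(k <- r) c k * fourier k x.

Lemma measurable_trig_poly r c : measurable_fun setT (trig_poly r c).
Proof.
by apply: measurable_sum => k; apply: measurable_funM => //; exact: measurable_fourier.
Qed.

Lemma trig_poly_bound r c x : `|trig_poly r c x| <= \sum_(k <- r) `|c k| * 2.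
Proof.
apply: (le_trans (ler_norm_sum _ _ _)); apply: ler_sum => k _.
by rewrite normrM ler_wpM2l// fourier_bound.
Qed.

Lemma theta_trig_poly r c l : uniq r ->
  theta (trig_poly r c) l = if l \in r then c l else 0.
Proof.
move=> ur; have -> : theta (trig_poly r c) l = \sum_(k <- r) c k * (k == l)%:R.
  elim: r {ur} => [|k r IH].
    rewrite big_nil /theta /trig_poly.
    under eq_Rintegral do rewrite big_nil mul0r.
    by rewrite Rintegral_cst// mul0r.
  rewrite big_cons -IH -theta_fourier /theta.
  have fi m : cubem.-integrable setT (fun x => (fourier m x * fourier l x)%:E).
    apply: (@bounded_integrable_cube _ 4).
      by apply: measurable_funM; exact: measurable_fourier.
    move=> x; rewrite normrM; apply: (@le_trans _ _ (2 * 2)); last by lra.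
    by apply: ler_pM => //; exact: fourier_bound.
  transitivity (\int[cubem]_x (c k * (fourier k x * fourier l x) +
      trig_poly r c x * fourier l x)).
    by apply: eq_Rintegral => x _; rewrite /trig_poly big_cons mulrDl mulrA.
  rewrite RintegralD//=.
  - by rewrite RintegralZl//; exact: fi.
  - exact: (integrableZl measurableT (c k) (fi k)).
  - apply: (@bounded_integrable_cube _ ((\sum_(k <- r) `|c k| * 2) * 2)).
      apply: measurable_funM; [exact: measurable_trig_poly|exact: measurable_fourier].
    move=> x; rewrite normrM; apply: ler_pM => //.
      exact: trig_poly_bound.
    exact: fourier_bound.
case: ifPn => lr.
  rewrite (bigD1_seq l)//= eqxx mulr1 big1 ?addr0// => k /negbTE ->.
  by rewrite mulr0.
rewrite big_seq big1// => k kr; case: eqP => [kl|]; last by rewrite mulr0.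
by rewrite -kl kr in lr.
Qed.

Lemma trig_poly_Lfun2 r c : trig_poly r c \in Lfun cubem 2%:E.
Proof.
rewrite inE/=; apply/andP; split; rewrite inE//=; first exact: measurable_trig_poly.
rewrite /finite_norm unlock poweR_lty//.
pose M : R := (\sum_(k <- r) `|c k| * 2) `^ 2.
have : cubem.-integrable setT (EFin \o (fun x => `|trig_poly r c x| `^ 2)).
  apply: (@bounded_integrable_cube _ M).
    apply: (measurableT_comp (measurable_powR _)) => //.
    by apply: measurableT_comp => //; exact: measurable_trig_poly.
  move=> x; rewrite ger0_norm ?powR_ge0// ge0_ler_powR ?nnegrE//.
    by rewrite (le_trans _ (trig_poly_bound r c x)).
  exact: trig_poly_bound.
by move/integrable_lty; apply.
Qed.

End trigonometric_polynomials.

(** * Truncation of the energy *)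

Section unordered_sums.
Context (R : realType) (T : choiceType).
Implicit Types (a : T -> R) (r : seq T).

Lemma esum_le_seq (D : set T) a (M : R) :
  (forall r, uniq r -> [set` r] `<=` D -> \sum_(k <- r) a k <= M) ->
  (\esum_(k in D) (a k)%:E <= M%:E)%E.
Proof.
move=> h; apply: ge_ereal_sup => _ [F [finF FD] <-].
rewrite fsbig_finite//= sumEFin lee_fin h//.
by apply: subset_trans FD => k /=; rewrite in_fset_set// inE.
Qed.

Lemma seq_le_esum (D : set T) a r : uniq r -> [set` r] `<=` D ->
  ((\sum_(k <- r) a k)%:E <= \esum_(k in D) (a k)%:E)%E.
Proof.
move=> ur rD; apply: esum_ge; exists [set` r]; first by split.
by rewrite -fsbig_seq// sumEFin.
Qed.

End unordered_sums.

Section frequency_ball.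
Context (d : nat).

Let signed_freq (m : nat) (t : {ffun 'I_d -> bool * 'I_m.+1}) : freq d :=
  [ffun i => (-1) ^+ (t i).1 * ((t i).2 : nat)%:Z].

(** Zero has two codes. Off [J] only [(false, ord0)] is accepted, so these coordinates contribute a
    factor 1 to the count; on [J] both are, whence the [undup] below. *)
Let in_ball (J : {set 'I_d}) (m : nat) : pred {ffun 'I_d -> bool * 'I_m.+1} :=
  fun t => [forall i, (i \notin J) ==> (t i == (false, ord0))] &&
    (\sum_(i < d) ((t i).2 : nat) <= m)%N.

Definition freq_ball (J : {set 'I_d}) (m : nat) : seq (freq d) :=
  undup [seq signed_freq t | t in @in_ball J m].

Lemma freq_ball_uniq J m : uniq (freq_ball J m).
Proof. exact: undup_uniq. Qed.

Lemma mem_freq_ball (J : {set 'I_d}) m (k : freq d) : (forall i, i \notin J -> k i = 0) ->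
  (\sum_(i < d) `|k i|%N <= m)%N -> k \in freq_ball J m.
Proof.
move=> kJ km; rewrite mem_undup.
have ki i : (`|k i| < m.+1)%N.
  by rewrite ltnS (leq_trans _ km)// (bigD1 i)//= leq_addr.
pose t := [ffun i => (k i < 0, Ordinal (ki i))].
have kt : k = signed_freq t.
  by apply/ffunP => i; rewrite !ffunE /=; exact: intEsign.
apply/mapP; exists t => //; rewrite mem_enum; apply/andP; split.
  apply/forallP => i; apply/implyP => iJ; rewrite ffunE.
  apply/eqP; congr (_, _); first by rewrite (kJ _ iJ).
  by apply/val_inj; rewrite /= (kJ _ iJ).
by under eq_bigr do rewrite ffunE/=.
Qed.

(** Each point of the ball has weight [expR (#|J| - sum |k_i| / q) >= 1], and the total weight
    factorises over the coordinates. Counting the enclosing cube instead would cost a factor of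
    order [#|J| ^ #|J|]. *)
Lemma size_freq_ball (R : realType) (J : {set 'I_d}) (q : nat) : (0 < q)%N ->
  (size (freq_ball J (#|J| * q)))%:R <= (expR 1 * (2 * q.+1%:R)) ^+ #|J| :> R.
Proof.
move=> q0; set m := (#|J| * q)%N; set s := #|J|.
have q0' : 0 < q%:R :> R by rewrite ltr0n.
pose F (i : 'I_d) (v : bool * 'I_m.+1) : R :=
  if i \in J then expR 1 * expR (- (v.2 : nat)%:R / q%:R)
  else (v == (false, ord0))%:R.
have F0 i v : 0 <= F i v by rewrite /F; case: ifP => _; rewrite ?mulr_ge0 ?expR_ge0.
have F1 (t : {ffun 'I_d -> bool * 'I_m.+1}) : t \in @in_ball J m -> 1 <= \prod_i F i (t i).
  move=> /andP[/forallP tJ tm].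
  rewrite (bigID (mem J))/= [X in _ * X]big1 ?mulr1; last first.
    by move=> i iJ; rewrite /F (negbTE iJ) (implyP (tJ i) iJ).
  under eq_bigr => i iJ do rewrite /F iJ -expRD.
  rewrite -expR_sum -[leLHS]expR0 ler_expR big_split/= sumr_const -/s -mulr_suml sumrN.
  rewrite mulNr subr_ge0 ler_pdivrMr//.
  rewrite -natrM -natr_sum ler_nat.
  apply: leq_trans tm; rewrite [leqRHS](bigID (mem J))/= leq_addr//.
apply: (@le_trans _ _ (\sum_(t : {ffun 'I_d -> bool * 'I_m.+1}) \prod_i F i (t i))).
  apply: (@le_trans _ _ (\sum_(t in @in_ball J m) 1)).
    rewrite sumr_const ler_nat; apply: leq_trans (size_undup _) _.
    by rewrite size_image.
  rewrite [leRHS](bigID (mem (@in_ball J m)))/= -[leLHS]addr0 lerD//.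
    by apply: ler_sum => t /F1.
  by apply: sumr_ge0 => t _; apply: prodr_ge0 => i _.
rewrite -(bigA_distr_bigA F).
have SJ i : i \in J -> \sum_v F i v <= expR 1 * (2 * q.+1%:R).
  move=> iJ; under eq_bigr do rewrite /F iJ.
  rewrite -mulr_sumr ler_wpM2l ?expR_ge0//.
  rewrite -(pair_bigA _ (fun (b : bool) (v : 'I_m.+1) => expR (- (v : nat)%:R / q%:R)))/=.
  rewrite big_bool/= -mulr2n -[X in X <= _]mulr_natl ler_wpM2l//.
  set p : R := expR (- q%:R^-1).
  have -> : \sum_(v < m.+1) expR (- v%:R / q%:R) = \sum_(v < m.+1) p ^+ v.
    by apply: eq_bigr => v _; rewrite /p -expRM_natl mulrN mulNr.
  (* Equivalent to [(1 - p)^-1 <= q + 1], the bound for the geometric sum; it follows from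
     [expR (1 / q) >= 1 + 1 / q]. *)
  have p1 : p * (q%:R + 1) <= q%:R.
    rewrite /p expRN mulrC ler_pdivrMr ?expR_gt0//.
    apply: le_trans (_ : q%:R * (1 + q%:R^-1) <= _).
      by rewrite mulrDr mulr1 divff ?gt_eqF.
    by rewrite ler_wpM2l ?expR_ge1Dx// ltW.
  have p0 : 0 <= p ^+ m.+1 by rewrite exprn_ge0 ?expR_ge0.
  have := subrX1 p m.+1; set S := \sum_(_ < _) _ => pS.
  have S0 : 0 <= S by apply: sumr_ge0 => v _; rewrite exprn_ge0 ?expR_ge0.
  rewrite -natr1.
  have : (1 - p) * S <= 1 by nra.
  nra.
rewrite (bigID (mem J))/= [X in _ * X]big1 ?mulr1; last first.
  move=> i iJ; under eq_bigr do rewrite /F (negbTE iJ).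
  rewrite (bigD1 (false, ord0))//= big1 ?addr0// => v /negbTE ->//.

apply: (@le_trans _ _ (\prod_(i in J) (expR 1 * (2 * q.+1%:R)))).
  apply: ler_prod => i iJ; rewrite SJ// andbT sumr_ge0//.
by rewrite prodr_const.
Qed.

End frequency_ball.

Section truncation.
Context (R : realType) (d : nat).

Definition freq_ball_at (J : {set 'I_d}) (m : nat) (j : 'I_d) : seq (freq d) :=
  [seq k : freq d <- freq_ball J m | k j != 0].

Lemma freq_ball_at_uniq J m j : uniq (freq_ball_at J m j).
Proof. by rewrite filter_uniq// freq_ball_uniq. Qed.

(* The frequencies outside the l1-ball of radius #|J| q satisfy
   sum_J k_i^2 >= #|J| q^2, since 2 q |k_i| <= k_i^2 + q^2. *)
Lemma outside_freq_ball (J : {set 'I_d}) (q : nat) (k : freq d) (t : R) :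
  (forall i, i \notin J -> k i != 0 -> t = 0) ->
  k \notin freq_ball J (#|J| * q) ->
  (#|J|)%:R * q%:R ^+ 2 * t ^+ 2 <= \sum_(i in J) ((k i)%:~R * t) ^+ 2.
Proof.
move=> tJ kB.
have [[i iJ ki]|kJ] := pselect (exists2 i, i \notin J & k i != 0).
  rewrite [in leLHS](tJ i iJ ki) expr0n mulr0.
  by apply: sumr_ge0 => l _; exact: sqr_ge0.
have {}kJ i : i \notin J -> k i = 0.
  by move=> iJ; apply/eqP; apply: contra_notT kJ => ki; exists i.
under eq_bigr do rewrite exprMn.
rewrite -mulr_suml ler_wpM2r ?sqr_ge0//.
have : (#|J| * q < \sum_(i < d) `|k i|)%N.
  by rewrite ltnNge; apply: contra kB; exact: mem_freq_ball.
rewrite (bigID (mem J))/= [X in (_ + X)%N]big1 ?addn0; last first.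
  by move=> i iJ; rewrite kJ.
rewrite -(ltr_nat R) natrM natr_sum.
have : (\sum_(i in J) 2 * q%:R * (`|k i|%N)%:R : R) <=
    \sum_(i in J) ((k i)%:~R ^+ 2 + q%:R ^+ 2).
  apply: ler_sum => i _.
  have -> : (k i)%:~R ^+ 2 = (`|k i|%N)%:R ^+ 2 :> R.
    by rewrite natr_absz intr_norm real_normK// num_real.
  rewrite -subr_ge0 (_ : _ - _ = ((`|k i|%N)%:R - q%:R) ^+ 2) ?sqr_ge0//; ring.
rewrite -mulr_sumr big_split/= sumr_const.
set S := \sum_(i in J) _; set Q := \sum_(i in J) _.
rewrite -mulr_natl.
have [->|q0] := posnP q.
  rewrite expr0n/= !mulr0 => _ _; apply: sumr_ge0 => i _; exact: sqr_ge0.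
have : 0 < q%:R :> R by rewrite ltr0n.
nra.
Qed.

(** Summing the Sobolev bounds over [J], the energy outside the ball is at most [#|J| L / (#|J| q^2)
    = L / q^2 <= kappa / 2]. *)
Lemma truncated_energy (th : freq d -> R) (J : {set 'I_d}) (q : nat) (j : 'I_d)
    (kappa L : R) :
  (0 < q)%N -> j \in J ->
  (forall (k : freq d) i, i \notin J -> k i != 0 -> th k = 0) ->
  (forall i, (\esum_(k in [set: freq d]) (((k i)%:~R * th k) ^+ 2)%:E <= L%:E)%E) ->
  (kappa%:E <= \esum_(k in [set k : freq d | k j != 0%R]) ((th k) ^+ 2)%:E)%E ->
  2 * L <= kappa * q%:R ^+ 2 ->
  kappa / 2 <= \sum_(k <- freq_ball_at J (#|J| * q) j) th k ^+ 2.
Proof.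
move=> q0 jJ thJ thL kth Lq.
set B := freq_ball_at _ _ _.
have J0 : 0 < (#|J|)%:R :> R by rewrite ltr0n; apply/card_gt0P; exists j.
have q0' : 0 < q%:R :> R by rewrite ltr0n.
suff : (\esum_(k in [set k : freq d | k j != 0%R]) ((th k) ^+ 2)%:E <=
    (\sum_(k <- B) th k ^+ 2 + L / q%:R ^+ 2)%:E)%E.
  move=> /(le_trans kth); rewrite lee_fin => h.
  have : L / q%:R ^+ 2 <= kappa / 2 by rewrite ler_pdivrMr ?exprn_gt0//; lra.
  lra.
apply: esum_le_seq => r ur rj.
rewrite (bigID (fun k => k \in freq_ball J (#|J| * q)))/=; apply: lerD.
  rewrite [leRHS](bigID (fun k => k \in r))/=.
  rewrite (_ : \sum_(k <- r | _) _ = \sum_(k <- B | k \in r) th k ^+ 2).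
    by rewrite lerDl sumr_ge0// => k _; exact: sqr_ge0.
  rewrite -[LHS]big_filter -[RHS]big_filter; apply: perm_big; apply: uniq_perm.
  - exact: filter_uniq.
  - by rewrite !filter_uniq// freq_ball_uniq.
  move=> k; rewrite !mem_filter andbC.
  by have [kr|//] := boolP (k \in r); rewrite (rj k kr).
have sq0 : 0 < (#|J|)%:R * q%:R ^+ 2 :> R by rewrite mulr_gt0// exprn_gt0.
rewrite ler_pdivlMr ?exprn_gt0// -(ler_pM2l J0) mulrCA mulr_suml.
apply: (@le_trans _ _ (\sum_(k <- r) \sum_(i in J) ((k i)%:~R * th k) ^+ 2)).
  rewrite [leRHS](bigID (fun k => k \in freq_ball J (#|J| * q)))/=.
  rewrite -[leLHS]add0r lerD//.
    by apply: sumr_ge0 => k _; apply: sumr_ge0 => i _; exact: sqr_ge0.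
  apply: ler_sum => k kB; rewrite mulrC.
  by apply: outside_freq_ball => // i iJ; exact: thJ.
rewrite exchange_big/=.
apply: (@le_trans _ _ (\sum_(i in J) L)).
  apply: ler_sum => i iJ; rewrite -lee_fin; apply: le_trans (thL i).
  by apply: seq_le_esum => // k.
by rewrite sumr_const mulr_natl.
Qed.

End truncation.

(** * Fourier coefficients off the pattern *)

Section pattern.
Context (R : realType) (d : nat).
Local Notation cubem := (cube_measure R d).

(* fbar only describes f on the cube; composing f with clamp makes it independent
   of the coordinates off the pattern everywhere. *)
Definition clamp (x : point R d) : point R d :=
  [tuple Num.max 0 (Num.min 1 (tnth x i : R)) : measurableTypeR R | i < d].

Lemma clamp_cube x : @cube R d (clamp x).
Proof.
move=> i; rewrite tnth_mktuple le_max lexx/= ge_max ler01/=.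
by rewrite ge_min lexx.
Qed.

Lemma clamp_id x : @cube R d x -> clamp x = x.
Proof.
move=> xc; apply: eq_from_tnth => i; rewrite tnth_mktuple.
have /andP[x0 x1] := xc i.
by rewrite (min_idPr x1) (max_idPr x0).
Qed.

Lemma measurable_clamp : measurable_fun setT clamp.
Proof.
apply/measurable_fun_tnthP => i.
rewrite (_ : _ \o _ = fun x => Num.max 0 (Num.min 1 (tnth x i : R))); last first.
  by apply/funext => x; rewrite /= tnth_mktuple.
apply: measurable_maxr => //; apply: measurable_minr => //.
exact: measurable_tnth.
Qed.

Lemma ae_clamp_id : {ae cubem, forall x, clamp x = x}.
Proof.
exists (~` @cube R d); split.
- by apply: measurableC; exact: measurable_cube.
- rewrite probability_setC; last exact: measurable_cube.
  by rewrite [X in (_ - X)%E]cube_measure_cube subee.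
- by move=> x /=; apply: contra_not => /clamp_id.
Qed.

(** [f] may be replaced by [f \o clamp], equal to it almost everywhere, to which the vanishing of
    the cosine integral along [j] applies. *)
Lemma theta_off_pattern (f : point R d -> R) (J : {set 'I_d})
    (fbar : point R #|J| -> R) (k : freq d) (j : 'I_d) :
  f \in Lfun cubem 2%:E ->
  (forall x, @cube R d x -> f x = fbar (subvector J x)) ->
  j \notin J -> k j != 0 -> theta f k = 0.
Proof.
move=> f2 fJ jJ kj.
have k0 : k != 0 by apply: contraNneq kj => ->; rewrite ffunE.
have fi : cubem.-integrable setT (EFin \o f).
  by apply/Lfun1_integrable; apply: Lfun_subset12 f2; rewrite fin_num_measure.
have mf : measurable_fun setT f by apply/measurable_EFinP; exact: measurable_int fi.
have mg : measurable_fun setT (f \o clamp).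
  by apply: measurableT_comp => //; exact: measurable_clamp.
have gi : cubem.-integrable setT (EFin \o (f \o clamp)).
  apply/integrableP; split; first exact/measurable_EFinP.
  have /integrableP[_] := fi; congr (_ < _)%E.
  apply: ge0_ae_eq_integral => //.
  - by apply: measurableT_comp => //; exact/measurable_EFinP.
  - by apply: measurableT_comp => //; exact/measurable_EFinP.
  by have := ae_clamp_id; apply: filterS => x xE _ /=; rewrite xE.
rewrite /theta /Rintegral -[RHS]/(fine 0); congr fine.
rewrite -[RHS](@integral_mul_cos_eq0 R d k j (phase R k) (fun x => f (clamp x) * Num.sqrt 2) kj).
- apply: ae_eq_integral => //.
  + apply/measurable_EFinP/measurable_funM => //; exact: measurable_fourier.
  + apply/measurable_EFinP/measurable_funM; last exact: measurable_cos_dot.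
    exact: measurable_funM.
  have := ae_clamp_id; apply: filterS => x xE _ /=.
  by rewrite xE fourier_phase// mulrA.
- exact: (integrableZr measurableT (Num.sqrt 2) gi).
move=> x y xy; congr (_ * _); rewrite !fJ; try exact: clamp_cube.
congr fbar; apply: eq_from_tnth => i; rewrite !tnth_mktuple xy//.
by apply: contraNneq jJ => <-; exact: enum_valP.
Qed.

(** A nonzero integer has square at least 1, so the Sobolev sum dominates the energy at [j]. Hence
    [sqrt (L / kappa) >= 1] as soon as the class is inhabited. *)
Lemma Sigma_kappa_le (kappa L : R) (s : nat) (f : point R d -> R) : (0 < s)%N ->
  Sigma kappa L s f -> kappa <= L.
Proof.
move=> s0 [_ fL [J [Js _ fk]]].
have /card_gt0P[j jJ] : (0 < #|J|)%N by rewrite Js.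
rewrite -lee_fin; apply: le_trans (fk j jJ) _; apply: le_trans (fL j).
rewrite [leRHS](esumID [set k : freq d | k j != 0%R])//; last first.
  by move=> k _; rewrite lee_fin sqr_ge0.
rewrite setTI; apply: (@le_trans _ _ (\esum_(k in [set k : freq d | k j != 0%R])
   (((k j)%:~R * theta f k) ^+ 2)%:E)%E); last first.
  rewrite leeDl// esum_ge0// => k _; rewrite lee_fin sqr_ge0//.
apply: le_esum => k /= kj; rewrite lee_fin exprMn ler_peMl ?sqr_ge0//.
by rewrite -rmorphXn/= ler1z -gtz0_ge1 exprn_even_gt0.
Qed.

End pattern.

(** * Upper bound *)

Section binomial_bounds.
Variable R : realType.

Lemma leq_bin_self d s : (0 < s < d)%N -> (d <= 'C(d, s))%N.
Proof.
elim: d s => [|d IH] [|s] // /andP[_ sd].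
rewrite binS; have [sd'|sd'] := ltnP s.+1 d.
  have d0 := IH s.+1 sd'; have : (0 < 'C(d, s))%N by rewrite bin_gt0; lia.
  lia.
have -> : s.+1 = d by lia.
have -> : s = d.-1 by lia.
by rewrite binn; case: d {IH sd sd'} => // d; rewrite /= binSn; lia.
Qed.

(** ['C(d, s) <= d^s / s!], and [s^s / s!] is a term of the series of [expR s]. *)
Lemma bin_le_expR d s : (0 < s <= d)%N ->
  ('C(d, s))%:R <= expR (s%:R * (ln (d%:R / s%:R) + 1)) :> R.
Proof.
move=> /andP[s0 sd].
have s0' : 0 < s%:R :> R by rewrite ltr0n.
have d0' : 0 < d%:R :> R by rewrite ltr0n (leq_trans s0).
rewrite expRM_natl expRD lnK ?posrE ?divr_gt0// exprMn -expRM_natl mulr1.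
have sf : s%:R ^+ s / s`!%:R <= expR s%:R :> R.
  case: s s0 {sd s0'} => // s _.
  apply: le_trans (expR_ge1Dxn s _) => //.
  by rewrite lerDr.
apply: (@le_trans _ _ (d%:R ^+ s / s`!%:R)).
  rewrite ler_pdivlMr ?ltr0n ?fact_gt0// -natrM bin_ffact -natrX ler_nat.
  elim: s {sd s0 s0' sf} d {d0'} => // s IH d.
  rewrite ffactnSr expnSr leq_mul//.
  exact: leq_subr.
rewrite expr_div_n -mulrA ler_wpM2l ?exprn_ge0//.
by rewrite ler_pdivlMl ?exprn_gt0.
Qed.

(** The left side is [(d / s)^s]. In ['C(d, s)] written as a product of s successive ratios, every
    ratio is at least [d / s]. *)
Lemma expR_le_bin d s : (0 < s <= d)%N ->
  expR (s%:R * ln (d%:R / s%:R)) <= ('C(d, s))%:R :> R.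
Proof.
move=> /andP[s0 sd].
have s0' : 0 < s%:R :> R by rewrite ltr0n.
have d0' : 0 < d%:R :> R by rewrite ltr0n (leq_trans s0).
rewrite expRM_natl lnK ?posrE ?divr_gt0//.
elim: s d s0 sd {s0' d0'} => // s IH [//|d] _ sd.
have [->|s0] := posnP s; first by rewrite bin1 expr1 divr1.
have sd' : (s <= d)%N by [].
have e : ('C(d.+1, s.+1))%:R = d.+1%:R / s.+1%:R * ('C(d, s))%:R :> R.
  apply: (mulfI (x := s.+1%:R)); first by rewrite pnatr_eq0.
  rewrite mulrA mulrCA divff ?pnatr_eq0// mulr1 -!natrM; congr _%:R.
  by rewrite mul_bin_diag.
rewrite e exprS ler_wpM2l ?divr_ge0//; apply: le_trans (IH d s0 sd').
rewrite lerXn2r ?nnegrE ?divr_ge0// ler_pdivrMr ?ltr0n// mulrAC ler_pdivlMr ?ltr0n//.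
by rewrite -!natrM ler_nat; lia.
Qed.

(** From [d / s >= 1 + 1 / s]. The logarithm may tend to 0; this bound still gives
    [s (ln (d/s) + 1) <= 3 s^2 ln (d/s)]. *)
Lemma ln_ratio_lb d s : (0 < s < d)%N -> (2 * s%:R)^-1 <= ln (d%:R / s%:R) :> R.
Proof.
move=> /andP[s0 sd].
have s0' : 1 <= s%:R :> R by rewrite ler1n.
have sd' : s%:R + 1 <= d%:R :> R by rewrite natr1 ler_nat.
have d0 : 0 < d%:R :> R by lra.
rewrite -[leRHS]opprK -lnV ?posrE ?divr_gt0//; last by lra.
rewrite invf_div lerNr.
have -> : s%:R / d%:R = 1 + (s%:R / d%:R - 1) :> R by ring.
apply: le_trans (le_ln1Dx _) _.
  by rewrite ltrBrDl subrr divr_gt0//; lra.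
have : s%:R / d%:R <= s%:R / (s%:R + 1) :> R.
  rewrite ler_wpM2l//.
  by rewrite lef_pV2 ?posrE//; lra.
have : s%:R / (s%:R + 1) - 1 <= - (2 * s%:R)^-1 :> R.
  rewrite -subr_ge0.
  have -> : - (2 * s%:R)^-1 - (s%:R / (s%:R + 1) - 1) = (s%:R - 1) / (2 * s%:R * (s%:R + 1)) :> R.
    by field; rewrite !gt_eqF//; lra.
  by rewrite divr_ge0 ?mulr_ge0//; lra.
lra.
Qed.

End binomial_bounds.

Section rate_arithmetic.
Variable R : realType.
Implicit Types L kappa : R.

(** Counting frequencies asks for [8 * expR 1]; the factor 96 also secures [48 s <= count_bound],
    through [96^s = 48^s 2^s]. *)
Definition count_base : R := 96 * expR 1.

(* With w = 34 + 4 a and a = count_base * sqrt L, w ^+ s >= (4 * a) ^+ s beats the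
   count_bound and w ^+ 4 >= 144 * 96 the numerical constants in
   chernoff_exponent_bound. *)
Definition upper_const L : R := (34 + 4 * count_base * Num.sqrt L) ^+ 2.

Definition count_bound L kappa (s : nat) : R :=
  (count_base * Num.sqrt (L / kappa)) ^+ s.

(** The largest [l] allowed by the two tail bounds when at most [count_bound] frequencies are
    tested. The branch 1/4 leads to the second term of the rate, the other branch to the first. *)
Definition chernoff_param L kappa (n s : nat) : R :=
  Num.min (1 / 4) (n%:R * kappa / (48 * count_bound L kappa s)).

Lemma count_base_ge : 96 <= count_base.
Proof. by rewrite /count_base ler_peMr// -expR0 ler_expR. Qed.

Lemma upper_const_gt0 L : 0 < upper_const L.
Proof.
have A96 := count_base_ge; rewrite /upper_const exprn_gt0//.
have : 0 <= count_base * Num.sqrt L by rewrite mulr_ge0 ?sqrtr_ge0//; lra.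
by rewrite -mulrA; lra.
Qed.

Lemma sqr_leq_expn4 s : (s ^ 2 <= 4 ^ s)%N.
Proof.
by rewrite (_ : 4 = 2 ^ 2)%N// -expnM mulnC expnM leq_exp2r// ltnW// ltn_expl.
Qed.

(** For small [ln (d / s)] this makes the estimate of the quadratic branch imply that of the linear
    one. *)
Lemma count_bound_ge L kappa s : 0 < kappa <= L -> (0 < s)%N ->
  48 * s%:R <= count_bound L kappa s.
Proof.
move=> /andP[k0 kL] s0.
have A96 := count_base_ge.
have u1 : 1 <= Num.sqrt (L / kappa) by rewrite -[leLHS]sqrtr1 ler_wsqrtr// ler_pdivlMr// mul1r.
apply: (@le_trans _ _ (96 ^+ s)); last first.
  rewrite lerXn2r// ?nnegrE//; first by rewrite mulr_ge0//; lra.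
  by rewrite -[leLHS]mulr1; apply: ler_pM.
rewrite -!natrM -natrX ler_nat.
rewrite (_ : 96 = 48 * 2)%N// expnMn leq_mul//; last by rewrite ltnW// ltn_expl.
by rewrite -{1}(expn1 48) leq_pexp2l.
Qed.

Lemma powR_rate (s : nat) (x : R) : 0 <= x ->
  (x `^ (2 / (4 + s%:R))) ^+ (4 + s) = x ^+ 2.
Proof.
move=> x0; rewrite -[LHS]powR_mulrn ?powR_ge0// -powRrM natrD divfK ?powR_mulrn//.
Qed.

(* With v^2 = kappa and w^2 = upper_const, the first term of the rate says
   v^(4+s) >= w^(4+s) ln(d/s) / n^2. *)
Lemma rate_first_term L kappa (n d s : nat) (x : R) :
  0 < L -> 0 < kappa -> 0 <= x ->
  upper_const L * x `^ (2 / (4 + s%:R)) <= kappa ->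
  (34 + 4 * count_base * Num.sqrt L) ^+ (4 + s) * x <= Num.sqrt kappa ^+ (4 + s).
Proof.
move=> L0 k0 x0 h; set w := 34 + _ in h *.
have A96 := count_base_ge.
have w0 : 0 <= w.
  by rewrite addr_ge0// mulr_ge0 ?sqrtr_ge0// mulr_ge0//; lra.
have lhs0 : 0 <= w ^+ (4 + s) * x by rewrite mulr_ge0// exprn_ge0.
have rhs0 : 0 <= Num.sqrt kappa ^+ (4 + s) by rewrite exprn_ge0// sqrtr_ge0.
rewrite -(@ler_pXn2r _ 2) ?nnegrE ?lhs0 ?rhs0//.
rewrite exprMn -!exprM ![(_ * 2)%N]mulnC !exprM sqr_sqrtr ?(ltW k0)//.
rewrite -(powR_rate s x0).
by rewrite -exprMn lerXn2r ?nnegrE ?mulr_ge0 ?sqr_ge0 ?powR_ge0// ltW.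
Qed.

(** The error of one test is at most ['C(d, s)^-4]; [claimA] and [claimB] treat the two branches of
    [chernoff_param]. *)
Lemma chernoff_exponent_bound L kappa (n d s : nat) :
  0 < L -> 0 < kappa <= L -> (0 < n)%N -> (0 < s < d)%N ->
  upper_const L * rate R n d s <= kappa ->
  4 * (s%:R * (ln (d%:R / s%:R) + 1)) <=
    chernoff_param L kappa n s * n%:R * kappa / 24.
Proof.
move=> L0 /[dup] kL /andP[k0 kL'] n0 sd kr.
have A96 := count_base_ge.
have s0 : (0 < s)%N by case/andP: sd.
set B := count_bound L kappa s; set l := ln _.
have n0' : 0 < n%:R :> R by rewrite ltr0n.
have s1 : 1 <= s%:R :> R by rewrite ler1n.
have l0 : (2 * s%:R)^-1 <= l := ln_ratio_lb R sd.
have s2 : 0 < 2 * s%:R :> R by rewrite mulr_gt0//; lra.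
have l1 : 1 <= 2 * s%:R * l by rewrite -[leLHS](mulfV (lt0r_neq0 s2)) ler_wpM2l// ltW.
have lp : 0 < l by apply: lt_le_trans l0; rewrite invr_gt0 mulr_gt0//; lra.
have sq0 : 0 < Num.sqrt (L / kappa) by rewrite sqrtr_gt0 divr_gt0.
have B0 : 0 < B by rewrite exprn_gt0// mulr_gt0//; lra.
have Bs : 48 * s%:R <= B by exact: count_bound_ge.
have [kr1 kr2] : upper_const L * (l / n%:R ^+ 2) `^ (2 / (4 + s%:R)) <= kappa /\
    upper_const L * (s%:R * l / n%:R) <= kappa.
  have D0 : 0 <= upper_const L by rewrite sqr_ge0.
  split; apply: le_trans kr; rewrite ler_wpM2l// /rate le_max lexx ?orbT//.
set H := s%:R * (l + 1).
(* Multiplying by [v^s] clears the negative powers of kappa, as [B v^s = a^s]. Then [H <= 3 s^2 l]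
   and [s^2 <= 4^s] are absorbed by [4^s a^s <= w^s]. *)
have claimB : (48 * 96) * B * H <= (n%:R * kappa) ^+ 2.
  have := rate_first_term n d L0 k0 (ltW (divr_gt0 lp (exprn_gt0 2 n0'))) kr1.
  set v := Num.sqrt kappa; set a := count_base * Num.sqrt L.
  have v0 : 0 < v by rewrite sqrtr_gt0.
  have a0 : 0 < a by rewrite mulr_gt0 ?sqrtr_gt0//; lra.
  have v2 : v ^+ 2 = kappa by rewrite sqr_sqrtr// ltW.
  have Bv : B * v ^+ s = a ^+ s.
    rewrite /B /count_bound sqrtrM ?(ltW L0)// sqrtrV ?(ltW k0)// -exprMn mulrA.
    by rewrite mulfVK// gt_eqF.
  rewrite -(mulrA 4) -/a mulrA ler_pdivrMr ?exprn_gt0// => hv.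
  have vs0 : 0 < v ^+ s by rewrite exprn_gt0.
  have w34 : 34 <= 34 + 4 * a by lra.
  have ws : 4 ^+ s * a ^+ s <= (34 + 4 * a) ^+ s.
    by rewrite -exprMn lerXn2r ?nnegrE//; lra.
  have w4 : (144 * 96) <= (34 + 4 * a) ^+ 4.
    apply: (@le_trans _ _ (34 ^+ 4)); first by lra.
    by rewrite lerXn2r ?nnegrE//; lra.
  have s4 : s%:R ^+ 2 <= 4 ^+ s :> R by rewrite -!natrX ler_nat sqr_leq_expn4.
  have as0 : 0 <= a ^+ s by rewrite exprn_ge0// ltW.
  rewrite -(ler_pM2r vs0).
  have -> : (n%:R * kappa) ^+ 2 * v ^+ s = v ^+ (4 + s) * n%:R ^+ 2.
    by rewrite -v2 exprD; ring.
  apply: le_trans hv; rewrite exprD.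
  apply: (@le_trans _ _ ((144 * 96) * (4 ^+ s * a ^+ s) * l)); last first.
    rewrite ler_wpM2r// ?(ltW lp)//; apply: ler_pM => //.
    by rewrite mulr_ge0// exprn_ge0.
  have -> : (48 * 96) * B * H * v ^+ s = (48 * 96) * H * a ^+ s by rewrite -Bv; ring.
  have -> : (144 * 96) * (4 ^+ s * a ^+ s) * l = (144 * 96) * l * 4 ^+ s * a ^+ s by ring.
  rewrite ler_wpM2r//; apply: (@le_trans _ _ ((144 * 96) * l * s%:R ^+ 2)); last first.
    by rewrite ler_wpM2l// mulr_ge0// ltW.
  rewrite /H; have : 0 <= s%:R * (2 * s%:R * l - 1) by rewrite mulr_ge0//; lra.
  have : 0 <= s%:R * l * (s%:R - 1) by rewrite !mulr_ge0//; lra.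
  nra.
have claimA : (4 * 96) * H <= n%:R * kappa.
  have [l2|l2] := leP (1 / 2) l.
    have : upper_const L * (s%:R * l) <= n%:R * kappa.
      by move: kr2; rewrite mulrA ler_pdivrMr// [kappa * _]mulrC.
    apply: le_trans.
    have : (12 * 96) <= upper_const L.
      rewrite /upper_const; have : 0 <= count_base * Num.sqrt L.
        by rewrite mulr_ge0 ?sqrtr_ge0//; lra.
      by rewrite -mulrA; move: (count_base * _) => a a0; nra.
    have sl0 : 0 <= s%:R * (l - 1 / 2) by rewrite mulr_ge0//; lra.
    move=> D1152; apply: (@le_trans _ _ ((12 * 96) * (s%:R * l))); first by rewrite /H; lra.
    by rewrite ler_wpM2r// mulr_ge0// ltW.
  (* For [l < 1/2], [32 H <= 48 s <= B], and [claimB] yields the square of the goal since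
     [48 * 96 * 32 = (4 * 96)^2]. *)
  have H0 : 0 <= H by rewrite mulr_ge0// addr_ge0// ltW.
  have Hs : 32 * H <= 48 * s%:R.
    by rewrite /H; have : 0 <= s%:R * (1 / 2 - l) by [rewrite mulr_ge0//; lra]; lra.
  have nk0 : 0 <= n%:R * kappa by rewrite mulr_ge0// ltW.
  have H0' : 0 <= 4 * 96 * H by lra.
  rewrite -(@ler_pXn2r _ 2) ?nnegrE ?H0' ?nk0//; apply: le_trans claimB.
  have : (B - 32 * H) * H >= 0 by rewrite mulr_ge0//; lra.
  nra.
rewrite /chernoff_param -/B /Num.min; case: ifP => _.
  by move: claimA; lra.
have -> : n%:R * kappa / (48 * B) * n%:R * kappa / 24 = (n%:R * kappa) ^+ 2 / ((12 * 96) * B).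
  by field; rewrite gt_eqF.
rewrite ler_pdivlMr ?mulr_gt0//; move: claimB; lra.
Qed.

End rate_arithmetic.

Section truncation_radius.
Variable R : realType.
Implicit Types L kappa : R.

Definition truncation_radius L kappa : nat :=
  (Num.truncn (Num.sqrt (2 * (L / kappa)))).+1.

Lemma truncation_radius_ge L kappa : 0 < kappa <= L ->
  2 * L <= kappa * (truncation_radius L kappa)%:R ^+ 2.
Proof.
move=> /andP[k0 kL].
have Lk0 : 0 <= 2 * (L / kappa) by rewrite mulr_ge0// divr_ge0//; lra.
have /andP[_ h] := truncn_itv (sqrtr_ge0 (2 * (L / kappa))).
rewrite -ler_pdivrMl// mulrC -mulrA -(sqr_sqrtr Lk0).
by rewrite lerXn2r ?nnegrE ?sqrtr_ge0// ltW.
Qed.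

Lemma size_freq_ball_at d L kappa (J : {set 'I_d}) (j : 'I_d) : 0 < kappa <= L ->
  (size (freq_ball_at J (#|J| * truncation_radius L kappa) j))%:R <=
    count_bound L kappa #|J|.
Proof.
move=> /andP[k0 kL].
set q := truncation_radius L kappa.
apply: (@le_trans _ _ (size (freq_ball J (#|J| * q)))%:R).
  by rewrite ler_nat size_filter count_size.
apply: le_trans (size_freq_ball R J (ltn0Sn _)) _.
rewrite /count_bound; set u := Num.sqrt (L / kappa).
have u1 : 1 <= u by rewrite /u -[leLHS]sqrtr1 ler_wsqrtr// ler_pdivlMr// mul1r.
have e0 : 0 < expR 1 :> R := expR_gt0 1.
(* Rounding up and the successor add 2 to [sqrt 2 * u]; both are at most [2 * u] because
   [u >= 1]. *)
have q4 : (q.+1)%:R <= 4 * u.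
  have /andP[h _] := truncn_itv (sqrtr_ge0 (2 * (L / kappa))).
  rewrite /q /truncation_radius; set t := Num.truncn _ in h *.
  rewrite -[t.+2%:R]natr1 -[t.+1%:R]natr1.
  have : Num.sqrt (2 * (L / kappa)) <= 2 * u.
    rewrite sqrtrM// ler_wpM2r ?sqrtr_ge0//.
    rewrite -(@ler_pXn2r _ 2) ?nnegrE ?sqrtr_ge0// sqr_sqrtr//; lra.
  lra.
have cb0 : 0 <= count_base R by have := count_base_ge R; lra.
rewrite lerXn2r ?nnegrE ?mulr_ge0 ?expR_ge0 ?sqrtr_ge0//.
have := ler_wpM2l (ltW e0) q4.
have : 0 <= expR 1 * u by rewrite mulr_ge0 ?expR_ge0//; lra.
rewrite -[(Num.truncn _).+2]/(q.+1) /count_base; lra.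
Qed.

End truncation_radius.

(** * The estimator and its error *)

Section estimator_construction.
Variables (R : realType) (L kappa : R) (n d : nat).

(** The sizes at which the Chernoff bound beats the number of candidate sets. Size [d] is left out:
    its rate is 0, so the condition on [kappa] would carry no information. *)
Definition admissible (s : nat) : bool :=
  (0 < s < d)%N && (upper_const L * rate R n d s <= kappa).

Definition test_freqs (J : {set 'I_d}) (j : 'I_d) : seq (freq d) :=
  freq_ball_at J (#|J| * truncation_radius L kappa) j.

(* Ranging over all admissible sizes at once makes the estimator independent of s. *)
Definition selected (y : freq d -> R) : {set 'I_d} :=
  [set j | [exists J : {set 'I_d}, [&& admissible #|J|, j \in J &
     kappa / 4 <= energy_stat n (test_freqs J j) y]]].

Lemma selected_measurable (J : {set 'I_d}) :
  <<s [set (fun y : freq d -> R => y k) @^-1` B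
        | k in [set: freq d] & B in (measurable : set (set R))] >>
    [set y | selected y = J].
Proof.
set S := [set _ | _ in _ & _ in _].
pose T : measurableType S.-sigma := g_sigma_algebraType S.
have mcoord k : measurable_fun setT (fun y : T => y k).
  move=> _ B mB; rewrite setTI; apply: sub_sigma_algebra.
  by exists k => //; exists B.
have mstat r : measurable_fun setT (fun y : T => energy_stat n r y).
  apply: measurable_sum => k; apply: measurable_funB => //.
  exact: measurable_funX.
pose A j : set T := \bigcup_(I in [set I : {set 'I_d} | admissible #|I| && (j \in I)])
  [set y : T | kappa / 4 <= energy_stat n (test_freqs I j) y].
have mA j : measurable (A j).
  apply: fin_bigcup_measurable => [|I _]; first exact: finite_finset.
  have := mstat (test_freqs I j) measurableT _ (measurable_itv `[kappa / 4, +oo[).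
  by rewrite setTI; congr measurable; apply/seteqP; split => y /=; rewrite in_itv/= andbT.
have AE j y : j \in selected y <-> A j y.
  rewrite inE; split.
    by move=> /existsP[I /and3P[aI jI hI]]; exists I => //=; rewrite aI.
  by move=> [I /= /andP[aI jI] hI]; apply/existsP; exists I; rewrite aI jI.
have -> : [set y | selected y = J] =
    \bigcap_(j in [set: 'I_d]) (if j \in J then A j else ~` A j).
  apply/seteqP; split => y /=.
    by move=> <- j _; case: ifPn => [/AE//|]; apply: contraNnot => /AE.
  move=> h; apply/setP => j; have := h j I.
  by case: ifPn => jJ hj; [apply/AE|apply/negbTE; apply: contra_notN hj => /AE].
suff: @measurable _ T (\bigcap_(j in [set: 'I_d]) (if j \in J then A j else ~` A j)) by [].
apply: fin_bigcap_measurable => [|j _]; first exact: finite_finset.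
by case: ifP => _; [exact: mA|exact: measurableC].
Qed.

Definition sparsity_estimator : estimator R d := Estimator selected_measurable.

End estimator_construction.

Section estimator_error.
Variables (R : realType) (L kappa : R) (n d : nat) (W : white_noise R d).
Local Notation P := (wn_prob W).
Hypotheses (L_gt0 : 0 < L) (n_gt0 : (0 < n)%N).

Lemma measurable_estimate (Jhat : estimator R d) (f : point R d -> R)
    (J : {set 'I_d}) : measurable [set w : wn_space W | Jhat (observation n f w) = J].
Proof.
have := estimate_measurable Jhat J; set S := [set _ | _ in _ & _ in _].
suff : <<s S >> `<=` [set A | measurable [set w : wn_space W | A (observation n f w)]] by apply.
apply: smallest_sub.
  split => /=.
  - by rewrite (_ : [set _ | _] = set0)//; apply/seteqP; split.
  - move=> A mA; rewrite (_ : [set _ | _] = ~` [set w | A (observation n f w)]).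
      exact: measurableC.
    by apply/seteqP; split => w /=; [move=> []|move=> ?; split].
  - move=> F mF.
    rewrite (_ : [set _ | _] = \bigcup_i [set w | F i (observation n f w)]).
      exact: bigcupT_measurable.
    by apply/seteqP; split.
move=> A [k _ [B mB <-]] /=.
have : measurable_fun setT (fun w : wn_space W => observation n f w k).
  by apply: measurable_funD => //; exact: measurable_funM.
by move=> /(_ measurableT _ mB); rewrite setTI.
Qed.

Lemma probability_bigsetU_le (I : Type) (r : seq I) (E : I -> set (wn_space W)) :
  (forall i, measurable (E i)) ->
  (P (\big[setU/set0]_(i <- r) E i) <= \sum_(i <- r) P (E i))%E.
Proof.
move=> mE; elim: r => [|i r IH]; first by rewrite !big_nil measure0.
rewrite !big_cons; apply: le_trans (measureU2 _ _ _) _ => //.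
  exact: bigsetU_measurable.
by rewrite leeD2l.
Qed.

(** Each size contributes exactly 1, which is why a union over all sets costs only a factor
    [d + 1]. *)
Lemma sum_inv_bin : \sum_(J : {set 'I_d}) ('C(d, #|J|)%:R)^-1 = (d.+1)%:R :> R.
Proof.
have Jd (J : {set 'I_d}) : (#|J| < d.+1)%N.
  by rewrite ltnS -[leqRHS]card_ord max_card.
rewrite (partition_big (fun J => Ordinal (Jd J)) xpredT)//=.
rewrite -[in RHS](card_ord d.+1) -sumr_const; apply: eq_bigr => k _.
rewrite (eq_bigr (fun=> ('C(d, k)%:R)^-1)); last by move=> J /eqP <-.
rewrite (eq_bigl (fun J => J \in [set A : {set 'I_d} | #|A| == k]%SET)); last first.
  by move=> J; rewrite inE -val_eqE.
rewrite sumr_const card_draws card_ord -[LHS]mulr_natr mulVf// pnatr_eq0 -lt0n.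
by rewrite bin_gt0 -ltnS.
Qed.

Let lam (s : nat) := chernoff_param L kappa n s.

(** Of ['C(d, s)^4], one factor pays for the sets of size [s]; the others give [d^3], which pays for
    the sizes and for [j] and leaves a bound of order [1 / d]. *)
Lemma admissible_exponent s : 0 < kappa <= L -> admissible L kappa n d s ->
  expR (- (lam s * n%:R * kappa / 24)) <= ('C(d, s)%:R)^-1 / d%:R ^+ 3.
Proof.
move=> kL /andP[/andP[s0 sd] ks].
have h := chernoff_exponent_bound L_gt0 kL n_gt0 (introT andP (conj s0 sd)) ks.
have C0 : 0 < 'C(d, s)%:R :> R by rewrite ltr0n bin_gt0 ltnW.
have d0 : 0 < d%:R :> R by rewrite ltr0n (leq_trans _ sd).
have dC : d%:R <= 'C(d, s)%:R :> R by rewrite ler_nat leq_bin_self// s0.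
rewrite expRN -invfM lef_pV2 ?posrE ?expR_gt0//; last by rewrite mulr_gt0 ?exprn_gt0.
apply: (@le_trans _ _ ('C(d, s)%:R ^+ 4)).
  by rewrite [leRHS]exprS ler_wpM2l// ?(ltW C0)// lerXn2r ?nnegrE.
have : 'C(d, s)%:R ^+ 4 <= expR (s%:R * (ln (d%:R / s%:R) + 1)) ^+ 4 :> R.
  rewrite lerXn2r ?nnegrE ?expR_ge0//.
  by apply: bin_le_expR; rewrite s0 ltnW.
by move/le_trans; apply; rewrite -expRM_natl ler_expR.
Qed.

Lemma chernoff_side (J : {set 'I_d}) (j : 'I_d) : 0 < kappa <= L ->
  [/\ 0 <= lam #|J|, lam #|J| <= 1 / 4 &
    48 * (size (test_freqs L kappa J j))%:R * lam #|J| <= n%:R * kappa].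
Proof.
move=> kL; have /andP[k0 kL'] := kL.
have A96 := count_base_ge R.
have B0 : 0 < count_bound L kappa #|J|.
  rewrite /count_bound exprn_gt0// mulr_gt0 ?sqrtr_gt0 ?divr_gt0//; lra.
have n0 : 0 < n%:R :> R by rewrite ltr0n.
have q0 : 0 <= n%:R * kappa / (48 * count_bound L kappa #|J|).
  by rewrite divr_ge0 ?mulr_ge0// ltW.
have lam0 : 0 <= lam #|J| by rewrite /lam /chernoff_param le_min q0 andbT; lra.
split => //; first by rewrite /lam /chernoff_param ge_min lexx.
apply: (@le_trans _ _ (48 * count_bound L kappa #|J| * lam #|J|)).
  by rewrite ler_wpM2r// ler_wpM2l// size_freq_ball_at.
rewrite mulrC -ler_pdivlMr ?mulr_gt0//.
by rewrite /lam /chernoff_param ge_min lexx orbT.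
Qed.

(** For [j] outside [J] the tests see pure noise whatever the candidate set, as their frequencies
    have [k j != 0]. For [j] in [J] it is enough that the test with the true set succeeds. In total
    [(d + 1) / d^2 + 1 / d^2 <= 3 / d]. *)
Lemma estimator_error_le (s : nat) (f : point R d -> R) (J : {set 'I_d}) :
  0 < kappa -> admissible L kappa n d s ->
  Sigma kappa L s f -> is_sparsity_pattern kappa s f J ->
  (error_prob W n (sparsity_estimator L kappa n d) f J <= (3 / d%:R)%:E)%E.
Proof.
move=> k0 ads fS [Js [fbar fE] fJ].
have /andP[/andP[s0 sd] ks] := ads.
have kL : 0 < kappa <= L by rewrite k0 (Sigma_kappa_le s0 fS).
have [f2 fL _] := fS.
have d0 : 0 < d%:R :> R by rewrite ltr0n (leq_trans _ sd).
have thJ (k : freq d) i : i \notin J -> k i != 0 -> theta f k = 0.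
  by move=> iJ ki; apply: theta_off_pattern f2 fE iJ ki.
(* The default [set0] lets the union run over all pairs, as the sum of inverse binomials
   requires. *)
pose FP (p : {set 'I_d} * 'I_d) : set (wn_space W) :=
  if [&& admissible L kappa n d #|p.1|, p.2 \in p.1 & p.2 \notin J] then
    [set w | kappa / 4 <= energy_stat n (test_freqs L kappa p.1 p.2) (noisy n (theta f) w)]
  else set0.
pose FN (j : 'I_d) : set (wn_space W) := if j \in J then
    [set w | energy_stat n (test_freqs L kappa J j) (noisy n (theta f) w) < kappa / 4]
  else set0.
have mstat r := @measurable_energy_stat R d W n (theta f) r.
have mFP p : measurable (FP p).
  rewrite /FP; case: ifP => // _.
  have := mstat (test_freqs L kappa p.1 p.2) measurableT _ (measurable_itv `[kappa / 4, +oo[).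
  by rewrite setTI; congr measurable; apply/seteqP; split => w /=; rewrite in_itv/= andbT.
have mFN j : measurable (FN j).
  rewrite /FN; case: ifP => // _.
  have := mstat (test_freqs L kappa J j) measurableT _ (measurable_itv `]-oo, kappa / 4[).
  by rewrite setTI; congr measurable; apply/seteqP; split => w /=; rewrite in_itv/=.
have PFP p : (P (FP p) <= (('C(d, #|p.1|)%:R)^-1 / d%:R ^+ 3)%:E)%E.
  rewrite /FP; case: ifP => [/and3P[a1 j1 jJ]|_]; last first.
    by rewrite measure0 lee_fin divr_ge0 ?exprn_ge0 ?invr_ge0// ltW.
  have [l0 l1 l2] := chernoff_side p.1 p.2 kL.
  have th0 (k : freq d) : k \in test_freqs L kappa p.1 p.2 -> theta f k = 0.
    by rewrite mem_filter => /andP[kj _]; exact: thJ kj.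
  apply: le_trans (@energy_stat_false_positive R d W n (theta f) _ kappa _ n_gt0
    (freq_ball_at_uniq _ _ _) l0 l1 (ltW k0) l2 th0) _.
  by rewrite lee_fin; exact: admissible_exponent.
have PFN j : (P (FN j) <= (('C(d, s)%:R)^-1 / d%:R ^+ 3)%:E)%E.
  rewrite /FN; case: ifP => [jJ|_]; last first.
    by rewrite measure0 lee_fin divr_ge0 ?exprn_ge0 ?invr_ge0// ltW.
  have [l0 l1 l2] := chernoff_side J j kL.
  have thk : kappa / 2 <= \sum_(k <- test_freqs L kappa J j) theta f k ^+ 2.
    apply: truncated_energy thJ fL (fJ j jJ) _ => //.
    exact: truncation_radius_ge.
  apply: le_trans (@energy_stat_false_negative R d W n (theta f) _ kappa _ n_gt0
    (freq_ball_at_uniq _ _ _) l0 l1 (ltW k0) l2 thk) _.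
  by rewrite lee_fin Js; exact: admissible_exponent.
pose BP := \big[setU/set0]_(p : {set 'I_d} * 'I_d) FP p.
pose BN := \big[setU/set0]_(j : 'I_d) FN j.
have mBP : measurable BP by exact: bigsetU_measurable.
have mBN : measurable BN by exact: bigsetU_measurable.
have sub : [set w | sparsity_estimator L kappa n d (observation n f w) <> J] `<=` BP `|` BN.
  move=> w /= hw; apply: contrapT => nB; apply: hw; apply/setP => j.
  have /not_orP[nP nN] := nB.
  rewrite inE; have [jJ|jJ] := boolP (j \in J).
    apply/existsP; exists J; rewrite Js ads jJ/= leNgt; apply/negP => lt.
    apply: nN; rewrite /BN -classical_sets.bigcup_seq.
    by exists j; rewrite /= ?mem_index_enum// /FN jJ.
  apply/negbTE/negP => /existsP[I /and3P[aI jI hI]].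
  apply: nP; rewrite /BP -classical_sets.bigcup_seq; exists (I, j); rewrite /= ?mem_index_enum//.
  by rewrite /FP/= aI jI jJ.
have merr : measurable [set w : wn_space W |
    sparsity_estimator L kappa n d (observation n f w) <> J].
  exact: (measurableC (measurable_estimate (sparsity_estimator L kappa n d) f J)).
apply: (@le_trans _ _ (P (BP `|` BN))).
  by apply: le_measure; rewrite ?inE//; exact: measurableU.
apply: le_trans (measureU2 _ _ _) _ => //.
have d1 : 1 <= d%:R :> R by rewrite ler1n (leq_trans _ sd).
have PBP : (P BP <= ((d.+1)%:R / d%:R ^+ 2)%:E)%E.
  apply: le_trans (probability_bigsetU_le _ mFP) _.
  apply: (@le_trans _ _ (\sum_(p : {set 'I_d} * 'I_d) (('C(d, #|p.1|)%:R)^-1 / d%:R ^+ 3)%:E)%E).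
    by apply: lee_sum => p _.
  rewrite sumEFin lee_fin.
  rewrite -(pair_bigA _ (fun (I : {set 'I_d}) (j : 'I_d) => ('C(d, #|I|)%:R)^-1 / d%:R ^+ 3))/=.
  under eq_bigr do rewrite sumr_const card_ord -[_ *+ d]mulr_natr -mulrA.
  rewrite -mulr_suml sum_inv_bin ler_wpM2l//.
  by rewrite [d%:R ^+ 3]exprS invfM mulrAC mulVf ?mul1r// gt_eqF.
have PBN : (P BN <= (1 / d%:R ^+ 2)%:E)%E.
  apply: le_trans (probability_bigsetU_le _ mFN) _.
  apply: (@le_trans _ _ (\sum_(j : 'I_d) (('C(d, s)%:R)^-1 / d%:R ^+ 3)%:E)%E).
    by apply: lee_sum => p _.
  rewrite sumEFin lee_fin sumr_const card_ord -[_ *+ d]mulr_natr -mulrA.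
  apply: ler_pM; rewrite ?invr_ge0 ?divr_ge0 ?mulr_ge0//.
  - by rewrite invf_le1 ?ltr0n ?ler1n bin_gt0 ltnW.
  by rewrite [d%:R ^+ 3]exprS invfM mulrAC mulVf ?mul1r// gt_eqF.
apply: le_trans (leeD PBP PBN) _; rewrite -EFinD lee_fin.
rewrite -mulrDl ler_pdivrMr ?exprn_gt0// -natr1 expr2 mulrA divfK ?gt_eqF//; lra.
Qed.

End estimator_error.

(** * Lower bound *)

Section least_favourable_signals.
Variables (R : realType) (d m : nat).
Local Notation T := {ffun 'I_d -> 'I_m.+1}.
Implicit Types (J : {set 'I_d}) (t : T) (k : freq d) (sg : {ffun T -> bool}).

Definition freq_of t : freq d := [ffun i => ((t i : nat)%:Z)].

(** Signs are indexed by the finite type [T], so that averaging is a finite sum; this left inverse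
    reads them off at a frequency. *)
Definition index_of k : T := [ffun i => inord `|k i|%N].

Lemma freq_ofK : cancel freq_of index_of.
Proof. by move=> t; apply/ffunP => i; rewrite !ffunE /= inord_val. Qed.

Definition signal_family J (i : 'I_d) : pred 'I_m.+1 :=
  if i \in J then predC1 ord0 else pred1 ord0.

(* {1, ..., m}^J, extended by 0 off J. *)
Definition signal_freqs J : seq (freq d) :=
  [seq freq_of t | t in family (signal_family J)].

Lemma signal_freqs_uniq J : uniq (signal_freqs J).
Proof. by rewrite map_inj_uniq ?enum_uniq//; exact: can_inj freq_ofK. Qed.

Lemma size_signal_freqs J : size (signal_freqs J) = (m ^ #|J|)%N.
Proof.
rewrite size_image card_family /= foldrE big_map big_enum/=.
rewrite (bigID (mem J))/= [X in (_ * X)%N]big1 ?muln1; last first.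
  by move=> i iJ; rewrite /signal_family (negbTE iJ) card1.
rewrite (eq_bigr (fun=> m)) ?prod_nat_const// => i iJ.
by rewrite /signal_family iJ cardC1 card_ord.
Qed.

Lemma mem_signal_freqs J k i : k \in signal_freqs J ->
  (k i != 0 :> int) = (i \in J) /\ `|k i| <= m%:Z.
Proof.
move=> /mapP[t]; rewrite mem_enum => /familyP tF ->; rewrite ffunE; split.
  have := tF i; rewrite /signal_family; case: ifP => iJ; rewrite inE.
    by move=> /eqP ti; apply/eqP => -[t0]; apply: ti; exact: val_inj.
  by move=> /eqP ->.
by rewrite ger0_norm// lez_nat -ltnS ltn_ord.
Qed.

Variable kappa : R.
Let N J : R := (m ^ #|J|)%:R.

(** All [N J] frequencies have [k j != 0] for every [j] in [J], so each relevant coordinate gets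
    energy exactly [kappa]. *)
Definition signal_amplitude J : R := Num.sqrt (kappa / N J).

Definition signal_coef J sg k : R :=
  (-1) ^+ sg (index_of k) * signal_amplitude J.

Definition signal J sg : point R d -> R :=
  trig_poly (signal_freqs J) (signal_coef J sg).

Lemma theta_signal J sg k :
  theta (signal J sg) k = if k \in signal_freqs J then signal_coef J sg k else 0.
Proof. by rewrite theta_trig_poly// signal_freqs_uniq. Qed.

Hypotheses (m_gt0 : (0 < m)%N) (kappa_ge0 : 0 <= kappa).

Lemma N_gt0 J : 0 < N J. Proof. by rewrite ltr0n expn_gt0 m_gt0. Qed.

Lemma signal_coef_sqr J sg k : signal_coef J sg k ^+ 2 = kappa / N J.
Proof.
rewrite exprMn sqrr_sign mul1r sqr_sqrtr// divr_ge0//.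
Qed.

Lemma sum_signal_freqs J : \sum_(k <- signal_freqs J) (kappa / N J) = kappa.
Proof.
rewrite big_const_seq count_predT iter_addr_0 size_signal_freqs -mulr_natr.
by rewrite divfK// gt_eqF// N_gt0.
Qed.

Lemma signal_pattern J sg : is_sparsity_pattern kappa #|J| (signal J sg) J.
Proof.
split=> //.
  (* Any preimage under [subvector J] will do: the frequencies vanish off [J], so the signal takes
     the same value at all of them. *)
  exists (fun u => signal J sg (xget classical_sets.point [set x | subvector J x = u])) => x _.
  case: xgetP => [y _ yx|/(_ x) []] //.
  rewrite /signal /trig_poly; apply: eq_big_seq => k kJ; congr (_ * _).
  suff dE : dot k x = dot k y by rewrite /fourier dE.
  apply: eq_bigr => i _; have [iJ|iJ] := boolP (i \in J).
    have := congr1 (fun u => tnth u (enum_rank_in iJ i)) yx.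
    by rewrite !tnth_mktuple enum_rankK_in// => ->.
  have [+ _] := mem_signal_freqs i kJ; rewrite (negbTE iJ) => /negbT.
  by rewrite negbK => /eqP ->; rewrite !mul0r.
move=> j jJ; rewrite -[leLHS](_ : (\sum_(k <- signal_freqs J) theta (signal J sg) k ^+ 2)%:E = _).
  apply: seq_le_esum; first exact: signal_freqs_uniq.
  by move=> k /= /(mem_signal_freqs j)[-> _].
rewrite -[in RHS](sum_signal_freqs J); congr (_%:E); apply: eq_big_seq => k kJ.
by rewrite theta_signal kJ signal_coef_sqr.
Qed.

Lemma signal_Sigma L J sg : kappa * m%:R ^+ 2 <= L ->
  Sigma kappa L #|J| (signal J sg).
Proof.
move=> kL; split; [exact: trig_poly_Lfun2| |by exists J; exact: signal_pattern].
move=> j; apply: esum_le_seq => r ur _.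
apply: le_trans kL.
apply: (@le_trans _ _ (\sum_(k <- signal_freqs J) m%:R ^+ 2 * (kappa / N J))); last first.
  by rewrite -mulr_sumr sum_signal_freqs mulrC.
apply: (@le_trans _ _ (\sum_(k <- [seq k <- r | k \in signal_freqs J]) m%:R ^+ 2 * (kappa / N J))).
  rewrite (bigID (fun k => k \in signal_freqs J))/= [X in _ + X]big1 ?addr0; last first.
    by move=> k /negbTE kJ; rewrite theta_signal kJ mulr0 expr0n.
  rewrite [leRHS]big_filter; apply: ler_sum => k kJ.
  rewrite theta_signal kJ exprMn signal_coef_sqr ler_wpM2r ?divr_ge0//.
  rewrite -[leLHS]real_normK ?num_real// lerXn2r ?nnegrE//.
  have [_ km] := mem_signal_freqs j kJ.
  by rewrite -intr_norm -[m%:R]/(m%:Z%:~R) ler_int.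
rewrite [leRHS](bigID (fun k => k \in r))/=.
rewrite -[leLHS]addr0 lerD//; last first.
  apply: sumr_ge0 => k _; rewrite mulr_ge0 ?sqr_ge0 ?divr_ge0//.
rewrite -[X in _ <= X]big_filter le_eqVlt (perm_big [seq k <- signal_freqs J | k \in r]) ?eqxx//=.
apply: uniq_perm; rewrite ?filter_uniq ?signal_freqs_uniq// => k.
by rewrite !mem_filter andbC.
Qed.

End least_favourable_signals.

Section hyperbolic_cosine.
Variables (R : realType) (d : nat) (W : white_noise R d).
Local Notation P := (wn_prob W).
Local Notation xi := (wn_xi W).

(** The hyperbolic cosine, here as the mean of [expR (e * x)] over a uniform sign [e]. *)
Definition hcos (x : R) : R := (expR x + expR (- x)) / 2.

Lemma hcos_ge0 x : 0 <= hcos x.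
Proof. by rewrite /hcos divr_ge0// addr_ge0 ?expR_ge0. Qed.

Lemma measurable_hcos : measurable_fun setT hcos.
Proof.
apply: measurable_funM => //; apply: measurable_funD => //.
exact: measurableT_comp.
Qed.

(** Expanding the square leaves exponential moments at [2 b] and [- (2 b)], both equal to
    [expR (2 * b ^+ 2)], and a constant. *)
Lemma expectation_hcos_sqr k (b : R) :
  (\int[P]_w ((hcos (b * xi k w) * expR (- (b ^+ 2 / 2))) ^+ 2)%:E =
   (hcos (b ^+ 2))%:E)%E.
Proof.
pose c := expR (- b ^+ 2) / 4.
have c0 : 0 <= c by rewrite divr_ge0 ?expR_ge0.
have me a : measurable_fun setT (fun w => expR (a * xi k w)).
  by apply: measurableT_comp => //; exact: measurable_funM.
transitivity (\int[P]_w (c%:E * ((expR (2 * b * xi k w))%:E +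
    ((expR (- (2 * b) * xi k w))%:E + 2%:E)))%E)%E.
  apply: eq_integral => w _; rewrite -!EFinD -EFinM; congr (_%:E).
  have -> : expR (2 * b * xi k w) = expR (b * xi k w) ^+ 2.
    by rewrite -expRM_natl; congr expR; ring.
  have -> : expR (- (2 * b) * xi k w) = expR (- (b * xi k w)) ^+ 2.
    by rewrite -expRM_natl; congr expR; ring.
  have -> : c = expR (- (b ^+ 2 / 2)) ^+ 2 / 4.
    by rewrite -expRM_natl /c; congr (expR _ / _); field.
  have := expRxMexpNx_1 (b * xi k w); rewrite /hcos.
  move: (expR (b * xi k w)) (expR (- (b * xi k w))) (expR (- (b ^+ 2 / 2))).
  move=> E F G EF; have -> : E ^+ 2 + (F ^+ 2 + 2) = (E + F) ^+ 2.
    by rewrite sqrrD EF; ring.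
  by field.
have nX : forall A : set R, measurable A -> distribution P (xi k) A = normal_prob 0 1 A.
  by move=> A mA; exact: wn_gaussian.
have mE a : measurable_fun setT (fun w => (expR (a * xi k w))%:E).
  by apply/measurable_EFinP.
have mE2 a : measurable_fun setT (fun w => (expR (a * xi k w))%:E + 2%:E)%E.
  exact: emeasurable_funD.
have ge2 a (w : wn_space W) : (0 <= (expR (a * xi k w))%:E + 2%:E)%E.
  by rewrite -EFinD lee_fin addr_ge0 ?expR_ge0.
have i2 : (\int[P]__ 2%:E = 2%:E)%E by rewrite integral_cst//= probability_setT mule1.
rewrite ge0_integralZl//; last 2 first.
- exact: (emeasurable_funD (mE _) (mE2 _)).
- by move=> w _; rewrite adde_ge0 ?ge2// lee_fin expR_ge0.
rewrite ge0_integralD// ge0_integralD//.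
rewrite !(expectation_normal_expR nX) i2.
rewrite -!EFinD -EFinM; congr (_%:E).
have -> : expR ((2 * b) ^+ 2 / 2) = expR (b ^+ 2) ^+ 2.
  by rewrite -expRM_natl; congr expR; field.
have -> : expR ((- (2 * b)) ^+ 2 / 2) = expR (b ^+ 2) ^+ 2.
  by rewrite -expRM_natl; congr expR; field.
have := expRxMexpNx_1 (b ^+ 2); rewrite /hcos /c.
move: (expR (b ^+ 2)) (expR (- b ^+ 2)) => E F EF.
transitivity (E * (E * F) / 2 + F / 2); first by field.
by rewrite EF mulr1 -mulrDl.
Qed.

End hyperbolic_cosine.

Section testing_bound.
Variables (R : realType) (d m n s : nat) (W : white_noise R d) (kappa : R).
Local Notation P := (wn_prob W).
Local Notation xi := (wn_xi W).
Local Notation T := {ffun 'I_d -> 'I_m.+1}.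
Implicit Types (J : {set 'I_d}) (sg : {ffun T -> bool}).
Hypotheses (n_gt0 : (0 < n)%N) (kappa_ge0 : 0 <= kappa).

Let b J : R := Num.sqrt n%:R * signal_amplitude m kappa J.

Let b_sqr J : b J ^+ 2 = n%:R * (kappa / (m ^ #|J|)%:R).
Proof. by rewrite exprMn !sqr_sqrtr// divr_ge0. Qed.

Let shift J sg (k : freq d) : R := Num.sqrt n%:R * theta (signal kappa J sg) k.

Definition mixture J (w : wn_space W) : R :=
  \prod_(k <- signal_freqs m J) (hcos (b J * xi k w) * expR (- (b J ^+ 2 / 2))).

Lemma mixture_ge0 J w : 0 <= mixture J w.
Proof. by apply: prodr_ge0 => k _; rewrite mulr_ge0 ?hcos_ge0 ?expR_ge0. Qed.

Lemma measurable_mixture J : measurable_fun setT (mixture J).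
Proof.
apply: measurable_prod => k _; apply: measurable_funM => //.
by apply: measurableT_comp; [exact: measurable_hcos|exact: measurable_funM].
Qed.

(** The signs are independent, so the average of the product over frequencies is the product of the
    averages, each a hyperbolic cosine. *)
Lemma average_likelihood J w :
  \sum_sg likelihood (signal_freqs m J) (shift J sg) w = 2 ^+ #|T| * mixture J w.
Proof.
(* The value 1 off the family extends the product to all of [T]; an idle sign then contributes the
   factor 2 like the others. *)
pose F (t : T) (e : bool) : R := if t \in family (@signal_family d m J) then
  expR ((-1) ^+ e * (b J * xi (freq_of t) w)) * expR (- (b J ^+ 2 / 2)) else 1.
transitivity (\sum_(sg : {ffun T -> bool}) \prod_(t : T) F t (sg t)).
  apply: eq_bigr => sg _; rewrite /likelihood /signal_freqs big_map big_enum/=.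
  rewrite big_mkcond/=; apply: eq_bigr => t _; rewrite /F.
  case: ifPn => // tJ.
  have fJ : freq_of t \in signal_freqs m J by apply/mapP; exists t; rewrite ?mem_enum.
  rewrite /shift theta_signal fJ /signal_coef freq_ofK -expRD; congr expR.
  set u := (-1) ^+ sg t.
  have u2 : u ^+ 2 = 1 by rewrite sqrr_sign.
  have -> : (Num.sqrt n%:R * (u * signal_amplitude m kappa J)) ^+ 2 = b J ^+ 2.
    by rewrite mulrCA exprMn u2 mul1r.
  by rewrite /b -!mulrA mulrCA.
rewrite -(bigA_distr_bigA F).
rewrite (eq_bigr (fun t : T => 2 * (if t \in family (@signal_family d m J) then
   hcos (b J * xi (freq_of t) w) * expR (- (b J ^+ 2 / 2)) else 1))); last first.
  move=> t _; rewrite big_bool/= /F; case: ifP => _; last by rewrite mulr1 [RHS]mulr2n.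
  by rewrite expr1 expr0 mulN1r mul1r /hcos; field.
rewrite big_split/= prodr_const -big_mkcond/=; congr (_ * _).
by rewrite /mixture /signal_freqs big_map big_enum.
Qed.

Lemma mixture_second_moment J :
  (\int[P]_w (mixture J w ^+ 2)%:E =
   (hcos (n%:R * (kappa / (m ^ #|J|)%:R)) ^+ (m ^ #|J|))%:E)%E.
Proof.
under eq_integral do rewrite -prodrXl.
rewrite (@mutually_independent_expectation_prod _ _ _ P _ xi (signal_freqs m J)
  (fun k x => (hcos (b J * x) * expR (- (b J ^+ 2 / 2))) ^+ 2)
  (fun=> hcos (b J ^+ 2))).
- rewrite big_const_seq count_predT iter_mulr_1 size_signal_freqs b_sqr//.
- exact: wn_indep.
- exact: signal_freqs_uniq.
- move=> k; apply: measurable_funX; apply: measurable_funM => //.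
  by apply: measurableT_comp; [exact: measurable_hcos|exact: measurable_funM].
- by move=> k x; exact: sqr_ge0.
- by move=> k; exact: expectation_hcos_sqr.
Qed.

Variable Jhat : estimator R d.
(** Success probabilities under all signals are transported to pure noise, where these events are
    disjoint for distinct [J]. *)
Let D J : set (wn_space W) := [set w | Jhat (fun k => (Num.sqrt n%:R)^-1 * xi k w) = J].

Let mD J : measurable (D J).
Proof.
have := @measurable_estimate R n d W Jhat (fun=> 0) J.
congr (measurable _); apply/seteqP; split => w /=; rewrite /D/= => <-; congr (Jhat _);
  apply/funext => k; rewrite /observation /theta;
  (under eq_Rintegral do rewrite mul0r);
  by rewrite Rintegral_cst// mul0r add0r.
Qed.

Lemma success_le_mixture J sg (p : R) :
  (forall sg, p%:E <= P [set w | Jhat (observation n (signal kappa J sg) w) = J])%E ->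
  (p%:E <= \int[P]_(w in D J) (mixture J w)%:E)%E.
Proof.
move=> hp; have n0 : 0 < Num.sqrt n%:R :> R by rewrite sqrtr_gt0 ltr0n.
have tilt sg' : (P [set w | Jhat (observation n (signal kappa J sg') w) = J] =
    \int[P]_(w in D J) (likelihood (signal_freqs m J) (shift J sg') w)%:E)%E.
  have off k : k \notin signal_freqs m J -> shift J sg' k = 0.
    by move=> kJ; rewrite /shift theta_signal (negbTE kJ) mulr0.
  apply/esym; apply: etrans (@exponential_tilt R d W (Num.sqrt n%:R)^-1 (signal_freqs m J)
    (shift J sg') (signal_freqs_uniq _ _) off [set y | Jhat y = J] (estimate_measurable Jhat J)) _.
  have obsE w : observation n (signal kappa J sg') w =
      (fun k => (Num.sqrt n%:R)^-1 * (xi k w + shift J sg' k)).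
    by apply/funext => k; rewrite /observation /shift mulrDr addrC mulKf// gt_eqF.
  by congr (P _); apply/seteqP; split => w /=; rewrite obsE.
have mlik sg' := @measurable_likelihood R d W (signal_freqs m J) (shift J sg').
have : (\sum_(sg' : {ffun T -> bool}) p%:E <= \sum_(sg' : {ffun T -> bool})
    \int[P]_(w in D J) (likelihood (signal_freqs m J) (shift J sg') w)%:E)%E.
  by apply: lee_sum => sg' _; rewrite -tilt.
rewrite -ge0_integral_sum//; last 2 first.
- by move=> sg'; apply/measurable_EFinP/measurable_funTS; exact: mlik.
- by move=> sg' w _; rewrite lee_fin likelihood_ge0.
under eq_integral do rewrite sumEFin average_likelihood EFinM.
have mmix : measurable_fun (D J) (fun w => (mixture J w)%:E).
  by apply/measurable_EFinP/measurable_funTS; exact: measurable_mixture.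
have mix0 w : D J w -> (0 <= (mixture J w)%:E)%E by rewrite lee_fin mixture_ge0.
have c0 : (0 <= (2 ^+ #|T|)%:E :> \bar R)%E by rewrite lee_fin exprn_ge0.
rewrite ge0_integralZl//.
rewrite sumEFin sumr_const card_ffun card_bool -[p *+ _]mulr_natl natrX EFinM.
by rewrite lee_pmul2l// lte_fin exprn_gt0.
Qed.

(** Since the [D J] are disjoint, the additive term M/4 is paid once and not for each of the M
    patterns. The M second moments, each divided by M, add at most another M/4, so
    [M p <= M / 2]. *)
Lemma success_le_half (p : R) : (0 < s <= d)%N ->
  hcos (n%:R * (kappa / (m ^ s)%:R)) ^+ (m ^ s) <= ('C(d, s))%:R / 4 ->
  (forall J sg, #|J| = s ->
     p%:E <= P [set w | Jhat (observation n (signal kappa J sg) w) = J])%E ->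
  p <= 1 / 2.
Proof.
move=> /andP[s0 sd] hX hp.
set M : R := ('C(d, s))%:R in hX *.
have M0 : 0 < M by rewrite ltr0n bin_gt0.
pose rs := enum [set J : {set 'I_d} | #|J| == s]%SET.
have rsE J : (J \in rs) = (#|J| == s) by rewrite mem_enum inE.
have sum_rs (x : R) : \sum_(J <- rs) x = M * x.
  by rewrite big_const_seq count_predT iter_addr_0 -cardE card_draws card_ord mulr_natl.
pose sg0 : {ffun T -> bool} := [ffun=> false].
have h1 : (\sum_(J <- rs) p%:E <= \sum_(J <- rs) \int[P]_(w in D J) (mixture J w)%:E)%E.
  rewrite big_seq [leRHS]big_seq; apply: lee_sum => J; rewrite rsE => /eqP Js.
  by apply: (success_le_mixture sg0) => sg; exact: hp.
have mms J : measurable_fun setT (fun w => M^-1 * mixture J w ^+ 2).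
  by apply: measurable_funM => //; apply: measurable_funX; exact: measurable_mixture.
have mmse J : measurable_fun setT (fun w => (M^-1 * mixture J w ^+ 2)%:E).
  exact/measurable_EFinP.
have ms0 J w : 0 <= M^-1 * mixture J w ^+ 2 by rewrite mulr_ge0 ?invr_ge0 ?sqr_ge0// ltW.
have h2 : (\sum_(J <- rs) \int[P]_(w in D J) (mixture J w)%:E
   <= \int[P]_w (\sum_(J <- rs) M^-1 * mixture J w ^+ 2 + M / 4)%:E)%E.
  under eq_bigr do rewrite integral_mkcond.
  rewrite -ge0_integral_sum//; last 2 first.
  - move=> J; apply/(measurable_restrictT _ (mD J)).
    by apply/measurable_EFinP/measurable_funTS; exact: measurable_mixture.
  - move=> J w _; rewrite patchE; case: ifP => // _.
    by rewrite lee_fin mixture_ge0.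
  apply: ge0_le_integral => //=.
  - move=> w _; apply: sume_ge0 => J _; rewrite patchE; case: ifP => // _.
    by rewrite lee_fin mixture_ge0.
  - apply: emeasurable_sum => J; apply/(measurable_restrictT _ (mD J)).
    by apply/measurable_EFinP/measurable_funTS; exact: measurable_mixture.
  - by apply/measurable_EFinP/measurable_funD => //; exact: measurable_sum.
  move=> w _; set J0 := Jhat (fun k => (Num.sqrt n%:R)^-1 * xi k w).
  have S0 : 0 <= \sum_(J <- rs) M^-1 * mixture J w ^+ 2 by apply: sumr_ge0.
  have DJ J : ((fun x => (mixture J x)%:E) \_ (D J)) w = (if J == J0 then mixture J w else 0)%:E.
    rewrite patchE; case: eqP => [JJ0|JJ0].
      by rewrite mem_set//= /D/= JJ0.
    by rewrite memNset// => DJw; apply: JJ0; rewrite -[LHS]DJw.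
  under eq_bigr do rewrite DJ.
  rewrite sumEFin lee_fin.
  have [J0r|J0r] := boolP (J0 \in rs); last first.
    rewrite big_seq_cond big1 ?addr_ge0// ?divr_ge0 ?(ltW M0)//.
    by move=> J /andP[Jr _]; case: eqP => // JJ0; rewrite -JJ0 Jr in J0r.
  rewrite [leLHS](bigD1_seq J0) ?enum_uniq//= eqxx big1 ?addr0; last first.
    by move=> J /negbTE ->.
  rewrite [in leRHS](bigD1_seq J0) ?enum_uniq//=.
  have S1 : 0 <= \sum_(J <- rs | J != J0) M^-1 * mixture J w ^+ 2 by apply: sumr_ge0.
  (* AM-GM; for each w only the term J = J0 survives on the left. *)
  suff : mixture J0 w <= M^-1 * mixture J0 w ^+ 2 + M / 4 by lra.
  rewrite -subr_ge0 (_ : _ - _ = M^-1 * (mixture J0 w - M / 2) ^+ 2).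
    by rewrite mulr_ge0 ?sqr_ge0// invr_ge0 ltW.
  by field; rewrite gt_eqF.
have h3 : (\int[P]_w (\sum_(J <- rs) M^-1 * mixture J w ^+ 2 + M / 4)%:E <= (M / 2)%:E)%E.
  have i4 : (\int[P]__ (M / 4)%:E = (M / 4)%:E)%E.
    by rewrite integral_cst//= probability_setT mule1.
  have M4 : 0 <= M / 4 by rewrite divr_ge0// ltW.
  under eq_integral do rewrite EFinD -sumEFin.
  rewrite ge0_integralD//; last first.
  - exact: emeasurable_sum.
  - by move=> w _; apply: sume_ge0 => J _; rewrite lee_fin.
  rewrite ge0_integral_sum//; last by move=> J w _; rewrite lee_fin.
  rewrite i4.
  have -> : (M / 2)%:E = ((\sum_(J <- rs) M^-1 * (M / 4))%:E + (M / 4)%:E)%E.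
    by rewrite sum_rs -EFinD; congr (_%:E); field; rewrite gt_eqF.
  rewrite leeD2r// -sumEFin big_seq [leRHS]big_seq; apply: lee_sum => J.
  rewrite rsE => /eqP Js; under eq_integral do rewrite EFinM.
  rewrite ge0_integralZl//.
  - rewrite mixture_second_moment Js -EFinM lee_fin ler_wpM2l// invr_ge0 ltW//.
  - by apply/measurable_EFinP; apply: measurable_funX; exact: measurable_mixture.
  - by move=> w _; rewrite lee_fin sqr_ge0.
  - by rewrite lee_fin invr_ge0 ltW.
have := le_trans h1 (le_trans h2 h3).
rewrite sumEFin lee_fin sum_rs.
by rewrite ler_pM2l// div1r.
Qed.

End testing_bound.

(** * Choice of the number of frequencies *)

Section lower_arithmetic.
Variable R : realType.
Implicit Types L kappa x D : R.

Lemma hcos_le_expR x : 0 <= x -> hcos x <= expR x.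
Proof.
by move=> x0; have : expR (- x) <= expR x by [rewrite ler_expR; lra]; rewrite /hcos; lra.
Qed.

(** For [x > 1/2] one has [x <= 2 x^2]. Below, the bounds [(1 - x)^-1] and [(1 + x)^-1] of the two
    exponentials average to [(1 - x^2)^-1]. *)
Lemma hcos_le_expR_sqr x : 0 <= x -> hcos x <= expR (2 * x ^+ 2).
Proof.
move=> x0; have [x2|x2] := leP x (1 / 2); last first.
  by apply: le_trans (hcos_le_expR x0) _; rewrite ler_expR expr2; nra.
have hx : expR x <= (1 - x)^-1.
  rewrite -[leLHS]invrK -expRN lef_pV2 ?posrE ?expR_gt0//; last lra.
  exact: expR_ge1Dx.
have hnx : expR (- x) <= (1 + x)^-1.
  by rewrite expRN lef_pV2 ?posrE ?expR_gt0 ?expR_ge1Dx//; lra.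
have y1 : 0 < 1 - x ^+ 2 by rewrite expr2; nra.
apply: (@le_trans _ _ (1 - x ^+ 2)^-1).
  have -> : (1 - x ^+ 2)^-1 = ((1 - x)^-1 + (1 + x)^-1) / 2.
    by field; apply/and3P; split; rewrite gt_eqF//; lra.
  by rewrite /hcos; lra.
rewrite -[leLHS]mul1r ler_pdivrMr//.
have := expR_ge1Dx (2 * x ^+ 2); set E := expR _ => hE.
apply: (@le_trans _ _ ((1 + 2 * x ^+ 2) * (1 - x ^+ 2))).
  have y4 : x ^+ 2 <= 1 / 4 by rewrite expr2; nra.
  have := sqr_ge0 x; move: (x ^+ 2) y4 => y y4 y0; nra.
by rewrite ler_wpM2r// ltW.
Qed.

(** 1/2 makes the exponents at most [s ln (d/s) / 2] in both regimes; [L / 4] ensures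
    [lower_const L <= kappa * m^2] for m the integer part of [sqrt (L / kappa)]. *)
Definition lower_const L : R := Num.min (1 / 2) (L / 4).

Lemma lower_const_gt0 L : 0 < L -> 0 < lower_const L.
Proof. by move=> L0; rewrite /lower_const lt_min; lra. Qed.

(** [sqrt M <= M / 4] from 16 on; this is where [d >= 16] comes from, through [d <= 'C(d, s)]. *)
Lemma expR_le_quarter (M y : R) : 16 <= M -> expR y <= M -> expR (y / 2) <= M / 4.
Proof.
move=> M16 yM; have : expR (y / 2) ^+ 2 <= M.
  by rewrite -expRM_natl (_ : 2 * _ = y)//; field.
by have := expR_gt0 (y / 2); rewrite expr2; nra.
Qed.

Lemma second_moment_bound L kappa (n d s : nat) :
  0 < L -> 0 < kappa <= L -> (0 < n)%N -> (0 < s < d)%N -> (16 <= d)%N ->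
  kappa <= lower_const L * rate R n d s ->
  exists m : nat, [/\ (0 < m)%N, kappa * m%:R ^+ 2 <= L &
    hcos (n%:R * (kappa / (m ^ s)%:R)) ^+ (m ^ s) <= ('C(d, s))%:R / 4].
Proof.
move=> L0 /andP[k0 kL] n0 /[dup] sd /andP[s0 sd'] d16.
set D := lower_const L; set M : R := ('C(d, s))%:R.
have D0 : 0 < D by exact: lower_const_gt0.
have [D1 D2] : D <= 1 / 2 /\ D <= L / 4.
  by rewrite /D /lower_const !ge_min !lexx orbT.
have M16 : 16 <= M by rewrite ler_nat (leq_trans d16)// leq_bin_self.
have eM : expR (s%:R * ln (d%:R / s%:R)) <= M by apply: expR_le_bin; rewrite s0 ltnW.
have l0 : 0 < ln (d%:R / s%:R) :> R.
  apply: lt_le_trans (ln_ratio_lb R sd); rewrite invr_gt0 mulr_gt0 ?ltr0n//.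
rewrite /rate; set l := ln _ in eM l0 *.
have n1 : 0 < n%:R :> R by rewrite ltr0n.
have s1 : 1 <= s%:R :> R by rewrite ler1n.
rewrite -[D * _]mulrC maxr_pMl ?(ltW D0)// le_max => /orP[h|h]; last first.
  (* The second term of the rate dominates [kappa]: a single frequency, with the linear bound for
     the exponent. *)
  exists 1; split => //; first by rewrite expr1n mulr1.
  rewrite exp1n expr1 divr1; apply: le_trans (hcos_le_expR _) _.
    by rewrite mulr_ge0// ltW.
  apply: le_trans (expR_le_quarter M16 eM); rewrite ler_expR.
  have : kappa * n%:R <= D * (s%:R * l) by rewrite -ler_pdivlMr// -mulrA [leRHS]mulrC.
  have : 0 <= s%:R * l by rewrite mulr_ge0// ltW.
  nra.
set u := Num.sqrt (L / kappa).
have u1 : 1 <= u by rewrite /u -[leLHS]sqrtr1 ler_wsqrtr// ler_pdivlMr// mul1r.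
have u2 : u ^+ 2 = L / kappa by rewrite sqr_sqrtr// divr_ge0// ltW.
have /andP[m1 m2] := truncn_itv (sqrtr_ge0 (L / kappa)).
rewrite -/u in m1 m2; set m := Num.truncn u in m1 m2.
exists m; have m0 : (0 < m)%N by rewrite /m truncn_gt0.
have m1' : 1 <= m%:R :> R by rewrite ler1n.
split => //.
  rewrite mulrC -ler_pdivlMr// -u2 lerXn2r ?nnegrE//; lra.
set N := (m ^ s)%N; have N0 : 0 < N%:R :> R by rewrite ltr0n expn_gt0 m0.
have x0 : 0 <= n%:R * (kappa / N%:R) by rewrite mulr_ge0 ?divr_ge0// ltW.
apply: (@le_trans _ _ (expR (2 * (n%:R * (kappa / N%:R)) ^+ 2) ^+ N)).
  by rewrite lerXn2r ?nnegrE ?hcos_ge0 ?expR_ge0// hcos_le_expR_sqr.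
rewrite -expRM_natl; apply: le_trans (expR_le_quarter M16 eM); rewrite ler_expR.
have -> : N%:R * (2 * (n%:R * (kappa / N%:R)) ^+ 2) = 2 * (n%:R * kappa) ^+ 2 / N%:R :> R.
  by field; rewrite gt_eqF.
rewrite ler_pdivrMr//.
set v := Num.sqrt kappa; set w := Num.sqrt D.
have v0 : 0 < v by rewrite sqrtr_gt0.
have w0 : 0 < w by rewrite sqrtr_gt0.
have v2 : v ^+ 2 = kappa by rewrite sqr_sqrtr// ltW.
have w2 : w ^+ 2 = D by rewrite sqr_sqrtr// ltW.
have ln0 : 0 <= l / n%:R ^+ 2 by rewrite divr_ge0// ltW.
have hv : v ^+ (4 + s) <= w ^+ (4 + s) * (l / n%:R ^+ 2).
  have lhs0 : 0 <= v ^+ (4 + s) by rewrite exprn_ge0// ltW.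
  have rhs0 : 0 <= w ^+ (4 + s) * (l / n%:R ^+ 2) by rewrite mulr_ge0// exprn_ge0// ltW.
  rewrite -(@ler_pXn2r _ 2) ?nnegrE ?lhs0 ?rhs0//.
  rewrite [leRHS]exprMn -(powR_rate s ln0) -!exprM ![(_ * 2)%N]mulnC !exprM v2 w2 -exprMn.
  by rewrite lerXn2r ?nnegrE ?mulr_ge0 ?powR_ge0 ?(ltW k0) ?(ltW D0)// mulrC.
(* From [4 D <= L] and [u < m + 1 <= 2 m]. Its s-th power [w^s <= v^s N] later trades the powers of
   kappa for N. *)
have wvm : w <= v * m%:R.
  have : 2 * w <= v * u.
    rewrite -(@ler_pXn2r _ 2) ?nnegrE ?mulr_ge0 ?(ltW v0) ?(ltW w0)//; last lra.
    by rewrite !exprMn v2 w2 u2 mulrCA divff ?gt_eqF// mulr1; lra.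
  have : u <= 2 * m%:R by move: m2; rewrite -[m.+1%:R]natr1; lra.
  by nra.
have wvs : w ^+ s <= v ^+ s * N%:R.
  by rewrite /N natrX -exprMn lerXn2r ?nnegrE ?mulr_ge0 ?(ltW v0) ?(ltW w0).
have vs0 : 0 < v ^+ s by rewrite exprn_gt0.
rewrite -(ler_pM2r vs0).
have -> : 2 * (n%:R * kappa) ^+ 2 * v ^+ s = 2 * n%:R ^+ 2 * v ^+ (4 + s).
  by rewrite -v2 exprD; ring.
apply: (@le_trans _ _ (2 * n%:R ^+ 2 * (w ^+ (4 + s) * (l / n%:R ^+ 2)))).
  by rewrite ler_wpM2l// mulr_ge0.
have -> : 2 * n%:R ^+ 2 * (w ^+ (4 + s) * (l / n%:R ^+ 2)) = 2 * D ^+ 2 * l * w ^+ s.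
  by rewrite -w2 exprD; field; rewrite gt_eqF.
apply: (@le_trans _ _ (2 * D ^+ 2 * l * (v ^+ s * N%:R))).
  by rewrite ler_wpM2l// !mulr_ge0// ltW.
have -> : s%:R * l / 2 * N%:R * v ^+ s = (s%:R / 2) * l * (v ^+ s * N%:R) by ring.
rewrite ler_wpM2r ?mulr_ge0 ?(ltW N0) ?(ltW vs0)// ler_wpM2r ?(ltW l0)//.
by rewrite expr2; nra.
Qed.

End lower_arithmetic.

Section risk_bounds.
Variables (R : realType) (L kappa : R) (n d s : nat) (W : white_noise R d).
Hypotheses (L_gt0 : 0 < L) (kappa_gt0 : 0 < kappa) (n_gt0 : (0 < n)%N).
Local Notation P := (wn_prob W).

Lemma worst_error_ge0 (Jhat : estimator R d) : (0 <= worst_error W n kappa L s Jhat)%E.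
Proof. by apply: ereal_sup_ubound; left. Qed.

Lemma worst_error_le (Jhat : estimator R d) (e : \bar R) : (0 <= e)%E ->
  (forall f J, Sigma kappa L s f -> is_sparsity_pattern kappa s f J ->
     error_prob W n Jhat f J <= e)%E ->
  (worst_error W n kappa L s Jhat <= e)%E.
Proof.
move=> e0 he; apply: ub_ereal_sup => _ [->//|[f [J [fS fJ ->]]]].
exact: he.
Qed.

Lemma worst_error_ge_half (Jhat : estimator R d) : kappa <= L ->
  (0 < s < d)%N -> (16 <= d)%N -> kappa <= lower_const L * rate R n d s ->
  ((1 / 2)%:E <= worst_error W n kappa L s Jhat)%E.
Proof.
move=> kL sd d16 kr.
have kL' : 0 < kappa <= L by rewrite kappa_gt0.
have [m [m0 mL hm]] := second_moment_bound L_gt0 kL' n_gt0 sd d16 kr.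
have sd' : (0 < s <= d)%N by case/andP: sd => -> /ltnW.
rewrite leNgt; apply/negP => lt2.
have fin : worst_error W n kappa L s Jhat \is a fin_num.
  by rewrite ge0_fin_numE ?worst_error_ge0// (lt_trans lt2) ?ltry.
set e := fine (worst_error W n kappa L s Jhat).
have e2 : e < 1 / 2 by rewrite -lte_fin fineK.
suff : 1 - e <= 1 / 2 by lra.
apply: (success_le_half (W := W) (Jhat := Jhat) n_gt0 (ltW kappa_gt0) sd' hm) => J sg Js.
have mS := @measurable_estimate R n d W Jhat (signal kappa J sg) J.
have : (P (~` [set w | Jhat (observation n (signal kappa J sg) w) = J]) <= e%:E)%E.
  rewrite fineK//; apply: ereal_sup_ubound; right.
  exists (signal kappa J sg), J; rewrite -Js; split => //.
  - exact: (signal_Sigma m0 (ltW kappa_gt0)).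
  - exact: (signal_pattern m0 (ltW kappa_gt0)).
rewrite probability_setC// -(fineK (fin_num_measure P _ mS)) -EFinB !lee_fin.
by rewrite lerBlDr addrC -lerBlDr.
Qed.

End risk_bounds.

(** * Uniform consistency *)

Section consistency.
Variables (R : realType) (L : R) (d s : nat -> nat) (kappa : nat -> R).
Hypothesis d_infty : d n @[n --> \oo] --> \oo.

Lemma uniformly_consistent_of_le (W : forall n, white_noise R (d n))
    (Jhat : forall n, estimator R (d n)) :
  (\forall n \near \oo, worst_error (W n) n (kappa n) L (s n) (Jhat n) <= (3 / (d n)%:R)%:E)%E ->
  uniformly_consistent W kappa L s Jhat.
Proof.
move=> hle; have h0 : \forall n \near \oo, 0 < (d n)%:R :> R.
  have dp : \forall n \near \oo, (0 < d n)%N := d_infty (nbhs_infty_gt 0).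
  by near=> n; rewrite ltr0n; near: n; exact: dp.
have dV : (d n)%:R^-1 @[n --> \oo] --> (0 : R).
  by apply/(gtr0_cvgV0 h0); exact: cvg_comp d_infty (@cvgr_idn R).
have d3 : (3 / (d n)%:R)%:E @[n --> \oo] --> (0 : R)%:E.
  apply: cvg_EFin; first exact: nearW.
  by rewrite -[X in _ --> X](mulr0 3); apply: cvgM dV; exact: cvg_cst.
apply: (squeeze_cvge _ (@cvg_cst _ 0%E _ _ _) d3).
by near=> n; rewrite worst_error_ge0/=; near: n.
Unshelve. all: by end_near.
Qed.

End consistency.

Section constant_estimator.
Variables (R : realType) (d : nat).

Lemma const_measurable (J0 J : {set 'I_d}) :
  <<s [set (fun y : freq d -> R => y k) @^-1` B
        | k in [set: freq d] & B in (measurable : set (set R))] >>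
    [set y | J0 = J].
Proof.
set S := [set _ | _ in _ & _ in _].
suff : @measurable _ (g_sigma_algebraType S) [set y | J0 = J] by [].
have [->|J0J] := eqVneq J0 J.
  by rewrite (_ : [set _ | _] = setT)//; apply/seteqP; split.
by rewrite (_ : [set _ | _] = set0)//; apply/seteqP; split => // y /= /eqP; rewrite (negbTE J0J).
Qed.

Definition const_estimator (J0 : {set 'I_d}) : estimator R d :=
  Estimator (const_measurable J0).

Lemma full_pattern_error (W : white_noise R d) (n : nat) (kappa : R) f J :
  is_sparsity_pattern kappa d f J ->
  error_prob W n (const_estimator [set: 'I_d]%SET) f J = 0%E.
Proof.
move=> [Jd _ _]; rewrite /error_prob (_ : [set _ | _] = set0) ?measure0//.
apply/seteqP; split => // w /=; apply; apply/esym/eqP.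
by rewrite eqEcard finset.subsetT cardsT card_ord Jd leqnn.
Qed.

End constant_estimator.

(** On an empty class [worst_error] is 0 and every estimator succeeds, hence the nonemptiness
    condition in the lower bound; it also yields [kappa n <= L]. The second estimator of the upper
    bound serves all sequences [s] below [d] at once. *)
Theorem proposition6 (R : realType) (L : R) (L_gt0 : 0 < L) :
  (exists Dup : R, 0 < Dup /\
    forall (C : R) (d dstar : nat -> nat) (kappa : nat -> R),
      d n @[n --> \oo] --> \oo ->
      (forall n, 0 < kappa n) ->
      (forall s : nat -> nat,
         sparsity_regime C s dstar d ->
         (\forall n \near \oo, kappa n >= Dup * rate R n (d n) (s n)) ->
         exists Jhat : forall n, estimator R (d n),
         forall W : forall n, white_noise R (d n),
           uniformly_consistent W kappa L s Jhat)
      /\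
      (exists Jhat : forall n, estimator R (d n),
       forall s : nat -> nat,
         sparsity_regime C s dstar d ->
         (forall n, (s n < d n)%N) ->
         (\forall n \near \oo, kappa n >= Dup * rate R n (d n) (s n)) ->
         forall W : forall n, white_noise R (d n),
           uniformly_consistent W kappa L s Jhat))
  /\
  (exists Dlow : R, 0 < Dlow /\
    forall (C : R) (d dstar s : nat -> nat) (kappa : nat -> R),
      d n @[n --> \oo] --> \oo ->
      (forall n, 0 < kappa n) ->
      sparsity_regime C s dstar d ->
      (\forall n \near \oo, Sigma (d := d n) (kappa n) L (s n) !=set0) ->
      (\forall n \near \oo, kappa n <= Dlow * rate R n (d n) (s n)) ->
      forall W : forall n, white_noise R (d n),
        ~ exists Jhat : forall n, estimator R (d n),
            uniformly_consistent W kappa L s Jhat).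
Proof.
split.
  exists (upper_const L); split; first exact: upper_const_gt0.
  move=> C d dstar kappa d_infty k0.
  pose est n := sparsity_estimator L (kappa n) n (d n).
  have est_le s n (W : white_noise R (d n)) : (0 < n)%N -> (0 < s < d n)%N ->
      upper_const L * rate R n (d n) s <= kappa n ->
      (worst_error W n (kappa n) L s (est n) <= (3 / (d n)%:R)%:E)%E.
    move=> n0 sd kr; apply: worst_error_le => [|f J fS fJ].
      by rewrite lee_fin divr_ge0.
    by apply: estimator_error_le fS fJ => //; rewrite /admissible sd.
  split.
    move=> s sreg hk.
    exists (fun n => if s n == d n then const_estimator R [set: 'I_(d n)]%SET else est n) => W.
    apply: uniformly_consistent_of_le => //; near=> n.
    have [s1 sd ds _] := sreg n; have {ds} sd := leq_trans sd ds.
    case: eqVneq => sdE; last first.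
      apply: est_le; [by near: n; exact: nbhs_infty_gt| |by near: n].
      by rewrite s1 ltn_neqAle sdE.
    apply: worst_error_le => [|f J _ fJ]; first by rewrite lee_fin divr_ge0.
    by rewrite sdE in fJ; rewrite (full_pattern_error _ _ fJ) lee_fin divr_ge0.
  exists est => s sreg sd hk W.
  apply: uniformly_consistent_of_le => //; near=> n.
  apply: est_le; [by near: n; exact: nbhs_infty_gt| |by near: n].
  by have [s1 _ _ _] := sreg n; rewrite s1 sd.
exists (lower_const L); split; first exact: lower_const_gt0.
move=> C d dstar s kappa d_infty k0 sreg Sne hk W [Jhat cJ].
have d16 : \forall n \near \oo, (16 <= d n)%N := d_infty _ (nbhs_infty_ge 16).
suff half : \forall n \near \oo,
    ((1 / 2)%:E <= worst_error (W n) n (kappa n) L (s n) (Jhat n))%E.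
  suff : ((1 / 2)%:E <= (0 : R)%:E)%E by rewrite lee_fin leNgt divr_gt0.
  exact: cvge_to_ge cJ half.
near=> n; have kn : kappa n <= lower_const L * rate R n (d n) (s n) by near: n.
have [s1 sd ds _] := sreg n; have {ds} sd := leq_trans sd ds.
(* At [s = d] the logarithm is [ln 1 = 0] and both terms of the rate vanish, contradicting
   [0 < kappa n]. *)
have sd' : (s n < d n)%N.
  rewrite ltn_neqAle sd andbT; apply/eqP => sdE; move: kn; rewrite sdE /rate.
  have d0 : (d n)%:R != 0 :> R by rewrite -sdE pnatr_eq0 -lt0n.
  rewrite divff// ln1 mulr0 !mul0r powR0 ?maxxx ?mulr0 ?leNgt ?k0//.
apply: worst_error_ge_half => //; last by near: n.
- by near: n; exact: nbhs_infty_gt.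
- have [f fS] : Sigma (d := d n) (kappa n) L (s n) !=set0 by near: n.
  exact: Sigma_kappa_le s1 fS.
- by rewrite s1.
Unshelve. all: by end_near.
Qed.
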